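(* Let $f\colon M_1 \rightarrow M_2$ be a morphism of symmetric spaces and $N_2\leq M_2$ a symmetric subspace. Then $N_1:=f^{-1}(N_2)$ is a symmetric subspace of $M_1$ and, for each base point $b_1\in N_1$, we have $$\mathrm{Lts}(N_1,b_1)=\mathrm{Lts}_{b_1}(f)^{-1}(\mathrm{Lts}(N_2,b_2))$$ with $b_2:=f(b_1)$.
   Context: Manifolds are smooth manifolds modelled on Banach spaces. A reflection space is a set $M$ with a multiplication $\mu\colon M\times M\to M$, $(x,y)\mapsto x\cdot y$, such that each $\mu_x:=\mu(x,\cdot)$ is an involutive automorphism of $(M,\mu)$ fixing $x$. A reflection subspace is a subset stable under $\mu$. A symmetric space is a smooth Banach manifold with a smooth multiplication making it a reflection space such that each $x$ is an isolated fixed point of $\mu_x$. Morphisms are smooth maps compatible with multiplication. For $b\in M$, the Lie triple system $\mathrm{Lts}(M,b)$ is the Banach space $T_bM$ with the following trilinear bracket: a derivation of $M$ is a smooth vector field $\xi\colon M\to TM$ with $\xi(x\cdot y)=T\mu(\xi(x),\xi(y))$; the derivations form a Lie algebra $\mathrm{Der}(M)$ with involution $\xi\mapsto T\mu_b\circ\xi\circ\mu_b$; its $(-1)$-eigenspace $\mathrm{Der}(M)_-$ is stable under $[\xi,\eta,\zeta]:=[[\xi,\eta],\zeta]$, and evaluation at $b$ is a linear isomorphism $\mathrm{Der}(M)_-\to T_bM$ transporting this bracket to $T_bM$. For a morphism $f$, $\mathrm{Lts}_{b}(f):=T_bf$. A subset $N\subseteq M$ is a submanifold if for each $x\in N$ there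 are a chart $\varphi\colon U\to V\subseteq E$ of $M$ at $x$ and a closed (not necessarily complemented) subspace $F\subseteq E$ with $\varphi(U\cap N)=V\cap F$. A symmetric subspace of $M$ is a reflection subspace that is a submanifold; it is itself a symmetric space, and for $b\in N$, with inclusion $\iota\colon N\to M$, $\mathrm{Lts}(N,b)$ is identified with its image under $T_b\iota$ in $\mathrm{Lts}(M,b)$. *)

(* Defs.v *)
From HB Require Import structures.
From mathcomp Require Import all_boot all_order all_algebra.
From mathcomp Require Import all_classical all_reals.
From mathcomp Require Import topology normedtype landau derive.
Set Implicit Arguments.
Unset Strict Implicit.
Unset Printing Implicit Defensive.
Import Order.TTheory GRing.Theory Num.Theory.
Import numFieldNormedType.Exports.
Local Open Scope classical_set_scope.
Local Open Scope ring_scope.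

Section Smooth.
Variable R : realType.

(* Class C^n on an open set U, in the form: f is C^(n+1) on U iff f is Frechet
   differentiable at every point of U and (x, v) |-> Df(x)v is C^n on U x E.
   For finite n this is slightly weaker than requiring Df to be C^(n-1) for the
   operator norm, but "C^n for all n" is the usual C^oo between Banach spaces.
   f is a total function whose values outside of U are irrelevant. *)
Fixpoint Cn (n : nat) (E F : normedModType R) (U : set E) (f : E -> F) : Prop :=
  if n is n'.+1 then
    (forall x, U x -> differentiable f x) /\
    Cn n' [set p : E * E | U p.1] (fun p : E * E => 'd f (p.1) p.2)
  else forall x, U x -> {for x, continuous f}.

Definition smooth_on (E F : normedModType R) (U : set E) (f : E -> F) :=
  forall n, Cn n U f.

Lemma diff_cvgE (E F : normedModType R) (f : E -> F) (l : {linear E -> F}) x :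
  continuous l ->
  (forall e : R, 0 < e -> \forall h \near 0,
    `|f (h + x) - f x - l h| <= e * `|h|) ->
  differentiable f x /\ 'd f x = l :> (E -> F).
Proof.
move=> lc H.
have e : f \o shift x = cst (f x) + l +o_ 0 id.
  apply/eqaddoP => eps eps0; have := H _ eps0; apply: filterS => h.
  by rewrite !fctE /= opprD addrA.
have dl := diff_unique lc e.
by split => //; apply/diff_locallyP; rewrite dl.
Qed.

Lemma diff_cvg (E F : normedModType R) (f : E -> F) x :
  differentiable f x -> forall e : R, 0 < e -> \forall h \near 0,
    `|f (h + x) - f x - 'd f x h| <= e * `|h|.
Proof.
move=> /diff_locally /eqaddoP H e e0; have := H _ e0; apply: filterS => h.
by rewrite !fctE /= opprD addrA.
Qed.

Lemma diff_congr (E F : normedModType R) (f g : E -> F) x :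
  (\forall y \near x, f y = g y) -> differentiable f x ->
  differentiable g x /\ 'd g x = 'd f x :> (E -> F).
Proof.
move=> fg df; apply: diff_cvgE; first exact: diff_continuous.
move=> e e0; have fgx := nbhs_singleton fg.
have fg' : \forall h \near 0, f (h + x) = g (h + x).
  have c : (h + x) @[h --> (0 : E)] --> x.
    rewrite -[X in _ --> X]add0r; apply: cvgD; [exact: cvg_id|exact: cvg_cst].
  exact: (c _ fg).
near=> h.
rewrite -fgx -(near fg' h)//.
by near: h; exact: diff_cvg.
Unshelve. all: by end_near. Qed.

Lemma continuous_id (T : topologicalType) : continuous (id : T -> T).
Proof. by move=> x; exact: cvg_id. Qed.

Lemma open_fst (E F : topologicalType) (U : set E) :
  open U -> open [set p : E * F | U p.1].
Proof. by move=> oU; apply: open_comp => // p _; exact: cvg_fst. Qed.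

Lemma Cn_congr n (E F : normedModType R) (U : set E) (f g : E -> F) :
  open U -> (forall x, U x -> f x = g x) -> Cn n U f -> Cn n U g.
Proof.
elim: n E F U f g => [|n IH] E F U f g oU fg /=.
  move=> fc x Ux; have := fc x Ux; rewrite /prop_for /continuous_at (fg x Ux).
  apply: cvg_trans; apply: near_eq_cvg.
  have := open_nbhs_nbhs (conj oU Ux); apply: filterS => y Uy.
  by rewrite fg.
move=> [df Cdf].
have H x : U x -> differentiable g x /\ 'd g x = 'd f x :> (E -> F).
  move=> Ux; apply: diff_congr; last exact: df.
  by have := open_nbhs_nbhs (conj oU Ux); apply: filterS => y; exact: fg.
split; first by move=> x /H[].
apply: IH Cdf; first exact: open_fst.
by move=> p /= /H[_ ->].
Qed.

Lemma Cn_mono n (E F : normedModType R) (U : set E) (f : E -> F) :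
  Cn n.+1 U f -> Cn n U f.
Proof.
elim: n E F U f => [|n IH] E F U f.
  by move=> [df _] x Ux; apply: differentiable_continuous; exact: df.
by move=> [df Cdf]; split => //; apply: IH.
Qed.

Lemma Cn_sub n (E F : normedModType R) (U V : set E) (f : E -> F) :
  V `<=` U -> Cn n U f -> Cn n V f.
Proof.
elim: n E F U V f => [|n IH] E F U V f VU /=; first by move=> H x /VU; exact: H.
by move=> [df Cdf]; split; [move=> x /VU; exact: df|apply: IH Cdf => p /VU].
Qed.

Lemma Cn_local n (E F : normedModType R) (U : set E) (f : E -> F) :
  (forall x, U x -> exists W : set E, W x /\ Cn n W f) -> Cn n U f.
Proof.
elim: n E F U f => [|n IH] E F U f H /=.
  by move=> x /H[W [Wx]]; exact.
split; first by move=> x /H[W [Wx []]] + _; exact.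
apply: IH => p /= /H[W [Wp [_ CW]]]; by exists [set p | W p.1].
Qed.

Lemma Cn_lin n (E F : normedModType R) (U : set E) (l : E -> F) :
  linear l -> continuous l -> Cn n U l.
Proof.
elim: n E F U l => [|n IH] E F U l ll lc /=; first by move=> x _; exact: lc.
pose L : {linear E -> F} := HB.pack l (GRing.isLinear.Build R E F _ l ll).
split; first by move=> x _; exact: (@linear_differentiable R E F L).
rewrite (_ : (fun p => _) = (fun p : E * E => l p.2)); last first.
  by apply/funext => p; rewrite (@diff_lin R E F L).
apply: IH; first by move=> a u v; rewrite -ll.
by move=> p; apply: (@continuous_comp _ _ _ snd l); [exact: cvg_snd|exact: lc].
Qed.

Lemma Cn_pair n (E F G : normedModType R) (U : set E) (f : E -> F)
  (g : E -> G) : open U ->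
  Cn n U f -> Cn n U g -> Cn n U (fun x => (f x, g x)).
Proof.
elim: n E F G U f g => [|n IH] E F G U f g oU /=.
  by move=> fc gc x Ux; apply: cvg_pair; [exact: fc|exact: gc].
move=> [df Cdf] [dg Cdg]; split.
  by move=> x Ux; apply: differentiable_pair; [exact: df|exact: dg].
have := IH _ _ _ _ _ _ (open_fst oU) Cdf Cdg.
apply: Cn_congr; first exact: open_fst.
by move=> p /= Up; rewrite diff_pair//; [exact: df|exact: dg].
Qed.

Lemma Cn_comp n (E F G : normedModType R) (U : set E) (V : set F)
  (f : E -> F) (g : F -> G) : open U -> (forall x, U x -> V (f x)) ->
  Cn n U f -> Cn n V g -> Cn n U (g \o f).
Proof.
elim: n E F G U V f g => [|n IH] E F G U V f g oU fUV.
  by move=> fc gc x Ux; apply: continuous_comp; [exact: fc|apply/gc/fUV].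
move=> Cf; move: (Cf) => /= [df Cdf] [dg Cdg]; split.
  by move=> x Ux; apply: differentiable_comp; [exact: df|apply/dg/fUV].
have oU' := @open_fst _ E _ oU.
have C1 : Cn n [set p : E * E | U p.1] (f \o fst).
  apply: (IH _ _ _ _ U) => //; last exact: Cn_mono.
  by apply: Cn_lin => //; move=> p; exact: cvg_fst.
have := IH _ _ _ _ [set p : F * F | V p.1] _ _ oU' _ (Cn_pair oU' C1 Cdf) Cdg.
move=> /(_ (fun p Up => fUV _ Up)).
apply: Cn_congr => //.
by move=> p Up; rewrite (diff_comp (df _ Up) (dg _ (fUV _ Up))).
Qed.

Lemma Cn_lift n (A B E : normedModType R) (U : set A) (g : A -> B)
  (j : B -> E) : open U -> linear j -> (forall y, `|j y| = `|y|) ->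
  closed (range j) -> Cn n U (j \o g) -> Cn n U g.
Proof.
move=> + jlin jn jcl.
pose J : {linear B -> E} := HB.pack j (GRing.isLinear.Build R B E _ j jlin).
have jB x y : j (x - y) = j x - j y by exact: (linearB J).
have jZ a x : j (a *: x) = a *: j x by exact: (linearZ_LR J).
have jinj : injective j.
  by move=> x y xy; apply/eqP; rewrite -subr_eq0 -normr_eq0 -jn jB xy subrr normr0.
elim: n A U g => [|n IH] A U g oU.
  move=> H x Ux; have /= := H x Ux; rewrite /continuous_at.
  move=> /cvgrPdist_lt G; apply/cvgrPdist_lt => e e0.
  by apply: filterS (G _ e0) => y; rewrite /= -jB jn.
move=> /= [djg Cdjg].
have H x : U x -> differentiable g x /\ forall v, j ('d g x v) = 'd (j \o g) x v.
  move=> Ux; have dx := djg _ Ux.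
  have /choice[h jh] : forall v, exists w : B, j w = 'd (j \o g) x v.
    move=> v.
    suff : range j ('d (j \o g) x v) by move=> [y _ <-]; exists y.
    rewrite -deriveE//.
    have /= dv := @diff_derivable _ _ _ (j \o g) x v dx.
    apply: (closed_cvg _ jcl) dv; near=> t.
    by exists (t^-1 *: (g (t *: v + x) - g x)) => //; rewrite jZ jB.
  have hlin : linear h.
    by move=> a u v; apply: jinj; rewrite jlin !jh linearP.
  pose H : {linear A -> B} := HB.pack h (GRing.isLinear.Build R A B _ h hlin).
  have hc : continuous H.
    have dc : continuous ('d (j \o g) x) by exact: diff_continuous.
    move=> v; have /= := dc v; rewrite /continuous_at.
    move=> /cvgrPdist_lt G; apply/cvgrPdist_lt => e e0.
    apply: filterS (G _ e0) => y; by rewrite /= -!jh -jB jn.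
  have hd (e : R) : 0 < e -> \forall k \near 0,
      `|g (k + x) - g x - H k| <= e * `|k|.
    move=> e0; have := diff_cvg dx e0; apply: filterS => k.
    by rewrite /= -jh -!jB jn.
  have [dg dE] := @diff_cvgE A B g H x hc hd.
  by split => // v; rewrite dE jh.
split; first by move=> x /H[].
apply: IH; first exact: open_fst.
apply: Cn_congr Cdjg; first exact: open_fst.
by move=> p /= /H[_ ->].
Unshelve. all: by end_near. Qed.

End Smooth.
Section Banach.
Variable R : realType.

Lemma prod_complete (E F : completeNormedModType R)
  (G : set_system ((E * F)%type : normedModType R)) : ProperFilter G -> cauchy G -> cvg G.
Proof.
move=> GF /cauchy_ballP Gc.
have c1 : cvg (fst @ G).
  apply: cauchy_cvg; apply/cauchy_ballP => e e0.
  rewrite near_map2; have := Gc _ e0.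
  by apply: filterS => -[x y] [].
have c2 : cvg (snd @ G).
  apply: cauchy_cvg; apply/cauchy_ballP => e e0.
  rewrite near_map2; have := Gc _ e0.
  by apply: filterS => -[x y] [].
apply/cvg_ex; exists (lim (fst @ G), lim (snd @ G)).
move=> A /(cvg_pair c1 c2); rewrite !nbhs_simpl /=.
by apply: filterS => -[].
Qed.

HB.instance Definition _ (E F : completeNormedModType R) :=
  Uniform_isComplete.Build (E * F)%type (@prod_complete E F).

(* Not necessarily complemented. *)
Record closed_subspace (E : normedModType R) := ClosedSubspace {
  cs_set :> set E;
  cs_zero : cs_set 0;
  cs_lin : forall (a : R) x y, cs_set x -> cs_set y -> cs_set (a *: x + y);
  cs_closed : closed cs_set
}.

Section csub.
Variables (E : normedModType R) (F : closed_subspace E).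

Definition cs_pred : {pred E} := fun x => x \in (F : set E).

Record csub := CSub {csval : E; _ : csval \in cs_pred}.

HB.instance Definition _ := [isSub for csval].
HB.instance Definition _ := [Choice of csub by <:].

Lemma cs_submod_closed : submod_closed cs_pred.
Proof.
split; first by rewrite unfold_in; apply/mem_set/cs_zero.
move=> a x y; rewrite !unfold_in => /set_mem Fx /set_mem Fy.
by apply/mem_set/cs_lin.
Qed.

HB.instance Definition _ :=
  GRing.isSubmodClosed.Build R E cs_pred cs_submod_closed.
HB.instance Definition _ := [SubChoice_isSubLmodule of csub by <:].

Definition csub_norm (x : csub) : R := `|csval x|.

Lemma csub_normD x y : csub_norm (x + y) <= csub_norm x + csub_norm y.
Proof. exact: ler_normD. Qed.

Lemma csub_normZ a x : csub_norm (a *: x) = `|a| * csub_norm x.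
Proof. exact: normrZ. Qed.

Lemma csub_norm0 x : csub_norm x = 0 -> x = 0.
Proof. by move=> /eqP; rewrite normr_eq0 => /eqP x0; exact/val_inj. Qed.

HB.instance Definition _ := @Lmodule_isNormed.Build R csub csub_norm
  csub_normD csub_normZ csub_norm0.

Lemma csval_linear : linear csval.
Proof. by []. Qed.

Lemma csval_norm x : `|csval x| = `|x|.
Proof. by []. Qed.

Lemma csval_continuous : continuous (csval : (csub : normedModType R) -> E).
Proof.
move=> x; have ? : Filter (nbhs x) by exact: nbhs_filter.
apply/cvgrPdist_lt => e e0.
exact: (@cvgr_dist_lt _ (csub : normedModType R) _ (nbhs x) _ id x).
Qed.

Lemma csval_range : range csval = F.
Proof.
apply/seteqP; split; first by move=> _ [[x Fx] _ <-]; exact: set_mem.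
by move=> x /mem_set Fx; exists (CSub Fx).
Qed.

End csub.

Lemma csub_complete (E : completeNormedModType R) (F : closed_subspace E)
  (G : set_system (csub F : normedModType R)) : ProperFilter G -> cauchy G -> cvg G.
Proof.
move=> GF /cauchy_ballP Gc.
have c : cvg (@csval E F @ G).
  apply: cauchy_cvg; apply/cauchy_ballP => e e0.
  rewrite near_map2; have := Gc _ e0.
  by apply: filterS => -[x y]; rewrite -!ball_normE.
have Fl : cs_set F (lim (@csval E F @ G)).
  apply: (closed_cvg _ (@cs_closed _ F) _ _ c).
  by apply: nearW => -[x Fx]; exact: set_mem.
apply/cvg_ex; exists (CSub (mem_set Fl)).
apply/cvgrPdist_lt => e e0.
have /cvgrPdist_lt/(_ e e0) := c.
by rewrite near_map.
Unshelve. all: by end_near. Qed.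

HB.instance Definition _ (E : completeNormedModType R) (F : closed_subspace E) :=
  Uniform_isComplete.Build (csub F) (@csub_complete E F).

End Banach.

(* Different charts may have different model spaces. The functions to_model and
   of_model are total; they are only meaningful on chart_dom and chart_cod. *)
Record chart (R : realType) (M : topologicalType) := Chart {
  model : completeNormedModType R;
  chart_dom : set M;
  chart_cod : set model;
  to_model : M -> model;
  of_model : model -> M;
  chart_dom_open : open chart_dom;
  chart_cod_open : open chart_cod;
  to_model_cod : forall x, chart_dom x -> chart_cod (to_model x);
  of_model_dom : forall y, chart_cod y -> chart_dom (of_model y);
  to_modelK : forall x, chart_dom x -> of_model (to_model x) = x;
  of_modelK : forall y, chart_cod y -> to_model (of_model y) = y;
  to_model_continuous : forall x, chart_dom x -> {for x, continuous to_model};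
  of_model_continuous : forall y, chart_cod y -> {for y, continuous of_model}
}.

Arguments model {R M} c.
Arguments chart_dom {R M} c.
Arguments chart_cod {R M} c.
Arguments to_model {R M} c.
Arguments of_model {R M} c.
Arguments chart_dom_open {R M} c.
Arguments chart_cod_open {R M} c.

Section Charts.
Variable R : realType.
Implicit Types M N : topologicalType.
Local Notation chart := (chart R).

(* Coordinate expression of f; the transition map from c to d is rep id c d. *)
Definition rep (M N : topologicalType) (f : M -> N) (c : chart M)
    (d : chart N) : model c -> model d :=
  to_model d \o f \o of_model c.
Arguments rep {M N} f c d.

Definition rep_dom (M N : topologicalType) (f : M -> N) (c : chart M)
    (d : chart N) : set (model c) :=
  [set y | chart_cod c y /\ chart_dom d (f (of_model c y))].
Arguments rep_dom {M N} f c d.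

Definition smooth_rep (M N : topologicalType) (f : M -> N) (c : chart M)
    (d : chart N) : Prop :=
  smooth_on (rep_dom f c d) (rep f c d).

Definition compatible (M : topologicalType) (c d : chart M) : Prop :=
  smooth_rep id c d /\ smooth_rep id d c.

Lemma rep_dom_open (M N : topologicalType) (f : M -> N) (c : chart M)
  (d : chart N) : continuous f -> open (rep_dom f c d).
Proof.
move=> fc; rewrite openE => y [cy dy] /=.
have cf : {for y, continuous (f \o of_model c)}.
  by apply: continuous_comp; [exact: of_model_continuous|exact: fc].
have H1 := open_nbhs_nbhs (conj (chart_cod_open c) cy).
have H2 := cf _ (open_nbhs_nbhs (conj (chart_dom_open d) dy)).
by apply: filterS (filterI H1 H2) => z [].
Qed.

Lemma smooth_rep_comp (A B C : topologicalType) (f : A -> B) (g : B -> C)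
  (c : chart A) (e : chart C) : continuous f -> continuous g ->
  (forall y, rep_dom (g \o f) c e y -> exists d : chart B,
     [/\ chart_dom d (f (of_model c y)), smooth_rep f c d & smooth_rep g d e]) ->
  smooth_rep (g \o f) c e.
Proof.
move=> fc gc H n; apply: Cn_local => y [cy ey].
have [d [dy fcd gde]] := H y (conj cy ey).
exists (rep_dom f c d `&` rep_dom (g \o f) c e); split; first by split.
have oW : open (rep_dom f c d `&` rep_dom (g \o f) c e).
  apply: openI; apply: rep_dom_open => //.
  by move=> x; apply: continuous_comp; [exact: fc|exact: gc].
apply: (@Cn_congr _ _ _ _ _ (rep g d e \o rep f c d)) => //.
  by move=> z [[cz dz] _]; rewrite /rep /= to_modelK.
apply: Cn_comp (gde n) => //.
  move=> z [[cz dz] [_ ez]]; split => /=.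
    exact: to_model_cod.
  by rewrite /rep /= to_modelK.
by apply: Cn_sub (fcd n) => z [].
Qed.

Lemma open_setX (S T : topologicalType) (A : set S) (B : set T) :
  open A -> open B -> open (A `*` B).
Proof.
move=> oA oB; apply: openI; first exact: open_fst.
by apply: open_comp => // p _; exact: cvg_snd.
Qed.

Section prod_chart.
Variables (M N : topologicalType) (c : chart M) (d : chart N).

Let to_p (x : M * N) : (model c * model d)%type :=
  (to_model c x.1, to_model d x.2).
Let of_p (y : model c * model d) : (M * N)%type :=
  (of_model c y.1, of_model d y.2).

Lemma prod_chart_subproof :
  [/\ open (chart_dom c `*` chart_dom d), open (chart_cod c `*` chart_cod d),
   (forall x, (chart_dom c `*` chart_dom d) x -> {for x, continuous to_p}) &
   (forall y, (chart_cod c `*` chart_cod d) y -> {for y, continuous of_p})].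
Proof.
split.
- by apply: open_setX; exact: chart_dom_open.
- by apply: open_setX; exact: chart_cod_open.
- move=> x [x1 x2]; apply: cvg_pair.
    apply: (@continuous_comp _ _ _ fst (to_model c)); first exact: cvg_fst.
    exact: to_model_continuous.
  apply: (@continuous_comp _ _ _ snd (to_model d)); first exact: cvg_snd.
  exact: to_model_continuous.
- move=> y [y1 y2]; apply: cvg_pair.
    apply: (@continuous_comp _ _ _ fst (of_model c)); first exact: cvg_fst.
    exact: of_model_continuous.
  apply: (@continuous_comp _ _ _ snd (of_model d)); first exact: cvg_snd.
  exact: of_model_continuous.
Qed.

Definition prod_chart : chart (M * N)%type.
Proof.
refine (@Chart R (M * N)%type (model c * model d)%type (chart_dom c `*` chart_dom d)
  (chart_cod c `*` chart_cod d) to_p of_p _ _ _ _ _ _ _ _).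
- by case: prod_chart_subproof.
- by case: prod_chart_subproof.
- by move=> x [x1 x2]; split; exact: to_model_cod.
- by move=> x [x1 x2]; split; exact: of_model_dom.
- by move=> [x y] [x1 x2]; rewrite /of_p /= !to_modelK.
- by move=> [x y] [x1 x2]; rewrite /to_p /= !of_modelK.
- by case: prod_chart_subproof.
- by case: prod_chart_subproof.
Defined.

End prod_chart.

Lemma smooth_rep_prod (A B M N : topologicalType) (f : A -> M) (g : B -> N)
  (c : chart A) (c' : chart B) (d : chart M) (d' : chart N) :
  continuous f -> continuous g ->
  smooth_rep f c d -> smooth_rep g c' d' ->
  smooth_rep (fun p : A * B => (f p.1, g p.2)) (prod_chart c c') (prod_chart d d').
Proof.
move=> fc gc fs gs n.
have oU : open (rep_dom (fun p : A * B => (f p.1, g p.2))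
    (prod_chart c c') (prod_chart d d')).
  apply: rep_dom_open => x; apply: cvg_pair.
    by apply: (@continuous_comp _ _ _ fst f); [exact: cvg_fst|exact: fc].
  by apply: (@continuous_comp _ _ _ snd g); [exact: cvg_snd|exact: gc].
apply: (@Cn_pair _ n _ _ _ _ (rep f c d \o fst) (rep g c' d' \o snd)) => //.
  apply: Cn_comp (fs n) => //.
    by move=> y [] [y1 y2] [] /=.
  by apply: Cn_lin => // y; exact: cvg_fst.
apply: Cn_comp (gs n) => //.
  by move=> y [] [y1 y2] [] /=.
by apply: Cn_lin => // y; exact: cvg_snd.
Qed.

Lemma prod_chart_compatible (M N : topologicalType) (c d : chart M)
  (c' d' : chart N) : compatible c d -> compatible c' d' ->
  compatible (prod_chart c c') (prod_chart d d').
Proof.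
have E : (fun p : M * N => (id p.1, id p.2)) = id by apply/funext => -[].
move=> [cd dc] [cd' dc']; split.
  by have := smooth_rep_prod (@continuous_id M) (@continuous_id N) cd cd'; rewrite E.
by have := smooth_rep_prod (@continuous_id M) (@continuous_id N) dc dc'; rewrite E.
Qed.

Section sub_chart.
Variables (M : topologicalType) (N : set M) (x0 : set_type N) (c : chart M).
Variables (F : closed_subspace (model c)).
Hypothesis cNF : to_model c @` (chart_dom c `&` N) = chart_cod c `&` F.

Let to_s (x : set_type N) : csub F := insubd 0 (to_model c (val x)).
Let of_s (y : csub F) : set_type N := insubd x0 (of_model c (csval y)).

Lemma sub_to_modelE x : chart_dom c (val x) -> csval (to_s x) = to_model c (val x).
Proof.
move=> cx; rewrite /to_s -[csval _]/(val _) insubdK//.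
have : (to_model c @` (chart_dom c `&` N)) (to_model c (val x)).
  by exists (val x) => //; split => //; exact: set_valP.
by rewrite cNF => -[_ Fx]; exact: mem_set.
Qed.

Lemma sub_of_modelE y : chart_cod c (csval y) -> val (of_s y) = of_model c (csval y).
Proof.
move=> cy; rewrite /of_s insubdK//.
have : (chart_cod c `&` F) (csval y) by split => //; case: y {cy} => y /= /set_mem.
by rewrite -cNF => -[z [cz Nz] <-]; rewrite to_modelK//; exact: mem_set.
Qed.


Lemma set_val_continuous (T : topologicalType) (A : set T) :
  continuous (val : set_type A -> T).
Proof. exact: (@initial_continuous (set_type A) T set_val). Qed.

Lemma sub_chart_subproof1 (x : set_type N) :
  chart_dom c (val x) -> {for x, continuous (to_s : _ -> (csub F : normedModType R))}.
Proof.
move=> cx; have ? : Filter (nbhs x) by exact: nbhs_filter.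
rewrite /prop_for /continuous_at.
apply/cvgrPdist_lt => e e0.
have cval : {for x, continuous (to_model c \o (val : set_type N -> M))}.
  apply: continuous_comp; first exact: set_val_continuous.
  exact: to_model_continuous.
have /cvgrPdist_lt/(_ e e0) H := cval.
have H2 : \forall y \near x, chart_dom c (val y).
  by apply: set_val_continuous; apply: open_nbhs_nbhs; split => //; exact: chart_dom_open.
apply: filterS (filterI H H2) => y [] /= + cy.
by rewrite -!sub_to_modelE.
Qed.

Lemma sub_chart_subproof2 (y : csub F : normedModType R) :
  chart_cod c (csval y) -> {for y, continuous of_s}.
Proof.
move=> cy; move=> U [_ [[W oW <-] /=]] Wy WU.
have cval : {for y, continuous (of_model c \o @csval R (model c) F)}.
  apply: continuous_comp; first exact: csval_continuous.
  exact: of_model_continuous.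
have H : \forall z \near y, W (of_model c (csval z)).
  by apply: cval; apply: open_nbhs_nbhs; split => //=; rewrite -(sub_of_modelE cy).
have H2 : \forall z \near y, chart_cod c (csval z).
  by apply: csval_continuous; apply: open_nbhs_nbhs; split => //; exact: chart_cod_open.
apply: filterS (filterI H H2) => z [Wz cz]; apply: WU.
by have := Wz; rewrite -(sub_of_modelE cz).
Qed.

(* The chart of the subspace N, with values in F, induced by a chart c of the
   ambient space that maps chart_dom c `&` N onto chart_cod c `&` F. *)
Definition sub_chart : chart (set_type N).
Proof.
refine (@Chart R (set_type N) (csub F) [set x | chart_dom c (val x)]
  [set y | chart_cod c (csval y)] to_s of_s _ _ _ _ _ _ _ _).
- by apply: open_comp => [x _|]; [exact: set_val_continuous|exact: chart_dom_open].
- by apply: open_comp => [x _|]; [exact: csval_continuous|exact: chart_cod_open].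
- by move=> x cx /=; rewrite sub_to_modelE//; exact: to_model_cod.
- by move=> y cy /=; rewrite sub_of_modelE//; exact: of_model_dom.
- move=> x cx; apply: val_inj; rewrite sub_of_modelE; last first.
    by rewrite sub_to_modelE//; exact: to_model_cod.
  by rewrite sub_to_modelE// to_modelK.
- move=> y cy; apply: val_inj; rewrite -[val _]/(csval _) sub_to_modelE.
    by rewrite sub_of_modelE// of_modelK.
  by rewrite sub_of_modelE//; exact: of_model_dom.
- exact: sub_chart_subproof1.
- exact: sub_chart_subproof2.
Defined.

Lemma smooth_rep_val : smooth_rep (val : set_type N -> M) sub_chart c.
Proof.
move=> n; apply: (@Cn_congr _ n _ _ _ (@csval R (model c) F)).
- exact: (@rep_dom_open _ _ (val : set_type N -> M) sub_chart c (@set_val_continuous _ _)).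
- move=> y [/= cy _]; rewrite /rep /=.
  by rewrite sub_of_modelE// of_modelK.
- by apply: Cn_lin; [exact: csval_linear|exact: csval_continuous].
Qed.

Lemma smooth_rep_lift (A : topologicalType) (g : A -> set_type N) (d : chart A) :
  continuous g -> smooth_rep (val \o g) d c -> smooth_rep g d sub_chart.
Proof.
move=> gc H n; apply: (@Cn_lift _ n _ _ _ _ _ (@csval R (model c) F)).
- exact: rep_dom_open.
- exact: csval_linear.
- exact: csval_norm.
- by rewrite csval_range; exact: cs_closed.
apply: (@Cn_congr _ n _ _ _ (rep (val \o g) d c)); last exact: H.
  exact: (@rep_dom_open _ _ g d sub_chart).
by move=> y [dy /= cy]; rewrite /rep /= sub_to_modelE.
Qed.

End sub_chart.
End Charts.
Arguments rep {R M N} f c d.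
Arguments rep_dom {R M N} f c d.

(* The atlas is indexed by the points of the manifold, the chart of index x being
   a chart at x. Every atlas gives rise to such a family, generating the same
   maximal atlas. The chart at x also serves to identify the tangent space at x
   with a Banach space. Hausdorffness is not assumed (it is automatic for
   symmetric spaces). *)
Record manifold (R : realType) := Manifold {
  points :> topologicalType;
  chart_at : points -> chart R points;
  chart_at_dom : forall x, chart_dom (chart_at x) x;
  chart_at_compatible : forall x y, compatible (chart_at x) (chart_at y)
}.
Arguments chart_at {R} _ x.

Section Manifolds.
Variable R : realType.
Implicit Types M N : manifold R.

(* The charts of the maximal atlas. *)
Definition smooth_chart M (c : chart R M) : Prop :=
  forall x, compatible c (chart_at M x).

Definition smooth M N (f : M -> N) : Prop :=
  continuous f /\ forall x y, smooth_rep f (chart_at M x) (chart_at N y).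

Lemma smooth_rep_smooth_chart M N (f : M -> N) (c : chart R M) (d : chart R N) :
  smooth f -> smooth_chart c -> smooth_chart d -> smooth_rep f c d.
Proof.
move=> [fc fs] cs ds; have idc := continuous_id.
apply: (@smooth_rep_comp R M N N f id) => // y [cy dy].
exists (chart_at N (f (of_model c y))); split; first exact: chart_at_dom.
- apply: (@smooth_rep_comp R M M N id f) => // z [cz dz].
  exists (chart_at M (of_model c z)); split; first exact: chart_at_dom.
    by have [] := cs (of_model c z).
  exact: fs.
- by have [] := ds (f (of_model c y)).
Qed.

Lemma smooth_id M : smooth (id : M -> M).
Proof.
split; first by move=> x; exact: cvg_id.
by move=> x y; have [] := chart_at_compatible x y.
Qed.

Definition prod_manifold M N : manifold R :=
  @Manifold R (M * N)%type
    (fun p => prod_chart (chart_at M p.1) (chart_at N p.2))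
    (fun p => conj (chart_at_dom p.1) (chart_at_dom p.2))
    (fun p q => prod_chart_compatible (chart_at_compatible p.1 q.1)
                                      (chart_at_compatible p.2 q.2)).

Definition tangent M (x : M) : completeNormedModType R := model (chart_at M x).

Definition tangent_map M N (f : M -> N) (x : M) :
    {linear tangent x -> tangent (f x)} :=
  'd (rep f (chart_at M x) (chart_at N (f x))) (to_model (chart_at M x) x).

Definition tangent_bundle M : Type := {x : M & tangent x}.

Definition bundle_map M N (f : M -> N) (v : tangent_bundle M) :
    tangent_bundle N :=
  existT _ (f (projT1 v)) (tangent_map f (projT1 v) (projT2 v)).

Definition vector_field M : Type := forall x : M, tangent x.

Definition section_of M (xi : vector_field M) (x : M) : tangent_bundle M :=
  existT _ x (xi x).

(* Principal part of xi in the chart c, as a function on chart_cod c. *)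
Definition field_rep M (xi : vector_field M) (c : chart R M) :
    model c -> model c :=
  fun y => let p := of_model c y in
    'd (rep id (chart_at M p) c) (to_model (chart_at M p) p) (xi p).
Arguments field_rep {M} xi c _.

Definition smooth_field M (xi : vector_field M) : Prop :=
  forall p, smooth_on (chart_cod (chart_at M p)) (field_rep xi (chart_at M p)).

Definition lie_bracket M (xi eta : vector_field M) : vector_field M :=
  fun x =>
    let c := chart_at M x in
    'd (field_rep eta c) (to_model c x) (xi x)
    - 'd (field_rep xi c) (to_model c x) (eta x).

Definition submanifold_chart M (N : set M) (x : M) (c : chart R M)
    (F : closed_subspace (model c)) : Prop :=
  [/\ smooth_chart c, chart_dom c x &
      to_model c @` (chart_dom c `&` N) = chart_cod c `&` (F : set (model c))].

Definition submanifold M (N : set M) : Prop :=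
  forall x, N x -> exists (c : chart R M) (F : closed_subspace (model c)),
    submanifold_chart N x F.

Section sub_manifold.
Variables (M : manifold R) (N : set M) (hN : submanifold N).

Definition ambient_chart (x : set_type N) : chart R M :=
  projT1 (cid (hN (set_valP x))).

Definition ambient_subspace (x : set_type N) :
    closed_subspace (model (ambient_chart x)) :=
  projT1 (cid (projT2 (cid (hN (set_valP x))))).

Lemma ambientP (x : set_type N) :
  submanifold_chart N (val x) (ambient_subspace x).
Proof. exact: projT2 (cid (projT2 (cid (hN (set_valP x))))). Qed.

Lemma ambientE (x : set_type N) :
  to_model (ambient_chart x) @` (chart_dom (ambient_chart x) `&` N) =
  chart_cod (ambient_chart x) `&` (ambient_subspace x : set _).
Proof. by have [] := ambientP x. Qed.

Definition sub_chart_at (x : set_type N) : chart R (set_type N) :=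
  sub_chart x (ambientE x).

Lemma sub_chart_at_dom x : chart_dom (sub_chart_at x) x.
Proof. by have [] := ambientP x. Qed.

Lemma ambient_smooth x : smooth_chart (ambient_chart x).
Proof. by have [] := ambientP x. Qed.

Lemma sub_chart_at_compatible x y :
  compatible (sub_chart_at x) (sub_chart_at y).
Proof.
have idc := continuous_id.
suff H z w : smooth_rep id (sub_chart_at z) (sub_chart_at w) by split.
apply: smooth_rep_lift => //.
apply: (@smooth_rep_comp R _ M M (val : set_type N -> M) id) => //.
  exact: set_val_continuous.
move=> p [zp wp]; exists (ambient_chart z); split.
- exact: (@of_model_dom _ _ (sub_chart_at z)).
- exact: smooth_rep_val.
- by apply: smooth_rep_smooth_chart (smooth_id M) _ _; exact: ambient_smooth.
Qed.

Definition sub_manifold : manifold R :=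
  Manifold sub_chart_at_dom sub_chart_at_compatible.

End sub_manifold.
End Manifolds.

Record symmetric_space (R : realType) := SymmetricSpace {
  sym_manifold :> manifold R;
  sym_mul : sym_manifold -> sym_manifold -> sym_manifold;
  sym_mul_smooth :
    smooth (fun p : prod_manifold sym_manifold sym_manifold =>
              sym_mul p.1 p.2);
  sym_mul_id : forall x, sym_mul x x = x;
  sym_mul_invol : forall x y, sym_mul x (sym_mul x y) = y;
  sym_mul_distr : forall x y z,
    sym_mul x (sym_mul y z) = sym_mul (sym_mul x y) (sym_mul x z);
  sym_mul_isolated : forall x, \forall y \near x, sym_mul x y = y -> y = x
}.

(* Carries the data of a Lie triple system only; the axioms are not required. *)
Record triple_system (R : realType) := TripleSystem {
  ts_space :> completeNormedModType R;
  ts_bracket : ts_space -> ts_space -> ts_space -> ts_space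
}.

Section SymmetricSpaces.
Variable R : realType.
Implicit Types M N : symmetric_space R.

Definition morphism M N (f : M -> N) : Prop :=
  smooth f /\ forall x y, f (sym_mul x y) = sym_mul (f x) (f y).

Definition symmetric_subspace M (N : set M) : Prop :=
  (forall x y, N x -> N y -> N (sym_mul x y)) /\ submanifold N.

Section sub_symmetric_space.
Variables (M : symmetric_space R) (N : set M) (hN : symmetric_subspace N).

Let sub := sub_manifold hN.2.

Definition sub_mul (x y : sub) : sub :=
  exist _ (sym_mul (val x) (val y))
    (mem_set (hN.1 _ _ (set_valP x) (set_valP y))).

Lemma sub_mul_smooth :
  smooth (fun p : prod_manifold sub sub => sub_mul p.1 p.2).
Proof.
have vc : continuous (val : set_type N -> M) by exact: set_val_continuous.
have mc : continuous (fun p : M * M => sym_mul p.1 p.2) := (sym_mul_smooth M).1.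
have vvc : continuous (fun p : set_type N * set_type N => (val p.1, val p.2) : M * M).
  move=> p; apply: cvg_pair.
    by apply: (@continuous_comp _ (set_type N) M fst val); [exact: cvg_fst|exact: vc].
  by apply: (@continuous_comp _ (set_type N) M snd val); [exact: cvg_snd|exact: vc].
have sc : continuous (fun p : sub * sub => sub_mul p.1 p.2).
  apply: continuous_comp_initial => p.
  by apply: (@continuous_comp _ (M * M)%type M
    (fun p : set_type N * set_type N => (val p.1, val p.2))
    (fun p : M * M => sym_mul p.1 p.2)); [exact: vvc|exact: mc].
split => // -[x y] z; apply: smooth_rep_lift => //.
apply: (@smooth_rep_comp R _ (M * M)%type M
  (fun p : set_type N * set_type N => (val p.1, val p.2))
  (fun p => sym_mul p.1 p.2)) => //.
move=> p [[px py] pz].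
exists (prod_chart (ambient_chart hN.2 x) (ambient_chart hN.2 y)); split.
- split; first exact: (@of_model_dom _ _ (sub_chart_at hN.2 x)).
  exact: (@of_model_dom _ _ (sub_chart_at hN.2 y)).
- by apply: smooth_rep_prod => //; exact: smooth_rep_val.
- apply: smooth_rep_smooth_chart (sym_mul_smooth M) _ (ambient_smooth hN.2 z).
  move=> q; apply: prod_chart_compatible; exact: ambient_smooth.
Qed.

Lemma sub_mul_id x : sub_mul x x = x.
Proof. by apply: val_inj; exact: sym_mul_id. Qed.

Lemma sub_mul_invol x y : sub_mul x (sub_mul x y) = y.
Proof. by apply: val_inj; exact: sym_mul_invol. Qed.

Lemma sub_mul_distr x y z :
  sub_mul x (sub_mul y z) = sub_mul (sub_mul x y) (sub_mul x z).
Proof. by apply: val_inj; exact: sym_mul_distr. Qed.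

Lemma sub_mul_isolated x : \forall y \near x, sub_mul x y = y -> y = x.
Proof.
have H : \forall y \near x, sym_mul (val x) (val y) = val y -> val y = val x.
  exact: (@set_val_continuous _ N x _ (sym_mul_isolated (val x))).
by apply: filterS H => y /= H xy; apply/val_inj/H;
  exact: (congr1 (fun z : set_type N => val z) xy).
Qed.

Definition sub_symmetric_space : symmetric_space R :=
  SymmetricSpace sub_mul_smooth sub_mul_id sub_mul_invol sub_mul_distr
    sub_mul_isolated.

End sub_symmetric_space.

Definition derivation M (xi : vector_field M) : Prop :=
  smooth_field xi /\
  forall x y, xi (sym_mul x y) =
    tangent_map (fun p : prod_manifold M M => sym_mul p.1 p.2) (x, y)
      (xi x, xi y).

(* The involution xi |-> T(mu_b) o xi o mu_b; its values are sections of TM. *)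
Definition invol_field M (b : M) (xi : vector_field M) (x : M) :
    tangent_bundle M :=
  bundle_map (sym_mul b) (section_of xi (sym_mul b x)).

Definition derivation_minus M (b : M) (xi : vector_field M) : Prop :=
  derivation xi /\
  forall x, invol_field b xi x = section_of (fun y => - xi y) x.

(* The inverse of evaluation at b, Der(M)_- -> T_b M, which is bijective; the
   value 0 of the other branch is never used. *)
Definition derivation_at M (b : M) (v : tangent b) : vector_field M :=
  if pselect (exists xi, derivation_minus b xi /\ xi b = v) is left h
  then projT1 (cid h) else fun x => 0.

Definition Lts_bracket M (b : M) (u v w : tangent b) : tangent b :=
  lie_bracket (lie_bracket (derivation_at u) (derivation_at v))
    (derivation_at w) b.

Definition Lts M (b : M) : triple_system R := TripleSystem (@Lts_bracket M b).

Definition Lts_map M N (f : M -> N) (b : M) : Lts b -> Lts (f b) :=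
  tangent_map f b.
Arguments Lts_map {M N} f b _.

(* Lts(N, b) as a subset of Lts(M, b): its image under the tangent map at b of
   the inclusion N -> M. *)
Definition Lts_sub M (N : set M) (hN : symmetric_subspace N) (b : M)
    (hb : N b) : set (Lts b) :=
  range (@Lts_map (sub_symmetric_space hN) M val (exist _ b (mem_set hb))).
Arguments Lts_sub {M N} hN b hb _.

End SymmetricSpaces.
Arguments Lts_map {R M N} f b _.
Arguments Lts_sub {R M N} hN b hb _.

(* Main.v *)
Require Import Defs.
From HB Require Import structures.
From mathcomp Require Import all_boot all_order all_algebra.
From mathcomp Require Import all_classical all_reals.
From mathcomp Require Import topology normedtype landau derive sequences.
From mathcomp Require Import interval_inference ring lra.
Set Implicit Arguments.
Unset Strict Implicit.
Unset Printing Implicit Defensive.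
Import Order.TTheory GRing.Theory Num.Theory.
Import numFieldNormedType.Exports.
Local Open Scope classical_set_scope.
Local Open Scope ring_scope.

(* Near a point b of a symmetric space the doubling map x |-> x . b fixes b and
   has derivative 2 id there: b being an isolated fixed point of its symmetry,
   that symmetry is conjugate to its derivative at b, which must then be - id,
   whereas x . x = x makes the two partial derivatives of the multiplication add
   up to id. Let g be the local inverse of the doubling map. Koenigs' limit
   phi = lim 2^k g^k converges to a chart at b, with derivative id, that turns
   doubling into multiplication by 2; this is the logarithm at b, obtained without
   differential equations.
   A morphism f, read in logarithmic charts, commutes with multiplication by 2 and
   is differentiable at 0, hence it is linear near 0. Applied to the inclusion of
   a symmetric subspace N, this shows that N is, near b, the preimage of Lts(N, b)
   under the logarithm. Therefore f^-1(N2) is, near b1, the preimage of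
   T f^-1(Lts(N2, b2)) under the logarithm at b1, which gives both the submanifold
   chart and, comparing with the same description of N1, the equality of triple
   systems. *)

(** * Mean value inequality and local Lipschitz bounds *)

(** The preimage of a submanifold under a smooth map is in general not a submanifold, and closed
    subspaces need not be complemented, so transversality is no help; linearity of morphisms in
    suitable charts takes its place. These charts must be smooth for [Cn], where one more derivative
    means passing from f to its tangent map on E x E. Both regularity proofs (local inverse, Koenigs
    limit) are therefore inductions that quantify over the spaces and whose hypotheses must be
    inherited by the tangent map [tmap]. Its domain is unbounded in the fibre, so these hypotheses
    cannot be uniform estimates on a ball: [Cn_inverse] assumes local Lipschitz bounds, and
    [half_basin] only that each orbit comes close to 0. As for convergence, g contracts by 2/3 near
    0 and 2 g - id vanishes there to second order, so the k-th increment of 2^k g^k is of order (2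
    (2/3)^2)^k = (8/9)^k; any contraction rate between 1/2 and 1/sqrt 2 would do. *)

Section Calculus.
Variable R : realType.

Lemma near_norm (E : normedModType R) (x0 : E) (P : E -> Prop) :
  (\forall x \near x0, P x) <->
  exists2 r : R, 0 < r & forall x, `|x - x0| < r -> P x.
Proof.
split.
  move=> /nbhs_ballP[r /= r0 H]; exists r => // x xr; apply: H.
  by rewrite -ball_normE /= distrC.
move=> [r r0 H]; apply/nbhs_ballP; exists r => //= x.
by rewrite -ball_normE /= distrC; exact: H.
Qed.

Lemma near_normI (E : normedModType R) (x0 : E) (P Q : E -> Prop) (b : R) :
  0 < b -> (\forall x \near x0, P x) -> (\forall x \near x0, Q x) ->
  exists2 r : R, 0 < r & r <= b /\ forall x, `|x - x0| < r -> P x /\ Q x.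
Proof.
move=> b0 HP HQ; have /near_norm[r r0 H] : \forall x \near x0, P x /\ Q x by exact: filterI.
exists (Num.min r b); first by rewrite lt_min r0 b0.
split; first by rewrite ge_min lexx orbT.
by move=> x; rewrite lt_min => /andP[/H].
Qed.

(** A supremum argument stands in for the real mean value theorem, u being vector-valued: the
    supremum of the parameters satisfying the bound satisfies it too, and if it were below 1 the
    local estimate there would carry the bound further. *)
Lemma locally_lipschitz_segment (F : normedModType R) (u : R -> F) (K : R) :
  0 <= K ->
  (forall s, 0 <= s <= 1 -> \forall h \near 0, `|u (h + s) - u s| <= K * `|h|) ->
  `|u 1 - u 0| <= K.
Proof.
move=> K0 H.
pose A := [set t : R | 0 <= t <= 1 /\ `|u t - u 0| <= K * t].
have A0 : A 0 by split; rewrite ?lexx ?ler01// subrr normr0 mulr0.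
have supA : has_sup A.
  by split; [exists 0|exists 1 => t [/andP[]]].
have s01 : 0 <= sup A <= 1.
  apply/andP; split; first exact: (ub_le_sup supA.2 A0).
  by apply: ge_sup; [exists 0|move=> t [/andP[]]].
have /near_norm[r r0 Hr] := H _ s01.
have [t [/andP[t0 t1] tA] st] := sup_adherent r0 supA.
have ts : t <= sup A.
  by apply: (ub_le_sup supA.2); split => //; apply/andP.
have sA : `|u (sup A) - u 0| <= K * sup A.
  have ts' : `|t - sup A| = sup A - t by rewrite distrC ger0_norm ?subr_ge0.
  have h1 : `|u t - u (sup A)| <= K * (sup A - t).
    by rewrite -ts' -[X in u X - _](subrK (sup A)); apply: Hr; rewrite subr0 ts'; lra.
  rewrite distrC in h1; have := ler_distD (u t) (u (sup A)) (u 0).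
  lra.
case/andP: s01 => s0; rewrite le_eqVlt => /orP[/eqP s1|s1].
  by move: sA; rewrite s1 mulr1.
pose d := Num.min (r / 2) (1 - sup A).
have d0 : 0 < d by rewrite lt_min divr_gt0//= subr_gt0.
have dr : d < r by rewrite gt_min; apply/orP; left; lra.
have d1 : d <= 1 - sup A by rewrite ge_min lexx orbT.
have h1 : `|u (d + sup A) - u (sup A)| <= K * d.
  by rewrite -{2}(gtr0_norm d0); apply: Hr; rewrite subr0 gtr0_norm.
have : A (d + sup A).
  split; first by apply/andP; split; lra.
  by have := ler_distD (u (sup A)) (u (d + sup A)) (u 0); lra.
by move=> /(ub_le_sup supA.2); lra.
Qed.

Lemma mean_value_inequality (E F : normedModType R) (f : E -> F) (a b : E) (K : R) :
  (forall t : R, 0 <= t <= 1 -> differentiable f (a + t *: (b - a)) /\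
     `|'d f (a + t *: (b - a)) (b - a)| <= K) ->
  `|f b - f a| <= K.
Proof.
move=> H.
have K0 : 0 <= K.
  have [_] := H 0 ltac:(by rewrite lexx ler01); exact: le_trans (normr_ge0 _).
(* The slack e absorbs the remainder of the differential: along the segment, u is locally Lipschitz
   with constant K + e. *)
apply/ler_addgt0Pr => e e0.
pose u t := f (a + t *: (b - a)).
have -> : f b = u 1 by rewrite /u scale1r addrC subrK.
have -> : f a = u 0 by rewrite /u scale0r addr0.
apply: locally_lipschitz_segment; first by rewrite addr_ge0// ltW.
move=> s s01; have [df dK] := H s s01.
pose x := a + s *: (b - a).
pose m := `|b - a| + 1.
have m0 : 0 < m by rewrite ltr_wpDl.
have := diff_cvg df (divr_gt0 e0 m0) => /near_norm[r r0 Hr].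
apply/near_norm; exists (r / m); first by rewrite divr_gt0.
move=> h; rewrite subr0 ltr_pdivlMr// => hr.
have uE : u (h + s) = f (h *: (b - a) + x).
  by rewrite /u /x scalerDl addrCA.
have ba : `|b - a| <= m by rewrite lerDl.
have := Hr (h *: (b - a)).
rewrite subr0 normrZ => /(_ (le_lt_trans (ler_wpM2l (normr_ge0 h) ba) hr)).
rewrite -/x -uE linearZ => h1.
rewrite -[u (h + s) - u s](subrK (h *: 'd f x (b - a))).
apply: le_trans (ler_normD _ _) _; rewrite normrZ mulrDl addrC lerD//.
  by rewrite mulrC ler_wpM2r.
apply: le_trans h1 _; rewrite mulrA mulrAC ler_wpM2r//.
by rewrite -mulrA ger_pMr// mulrC ler_pdivrMr// mul1r.
Qed.

End Calculus.

Section Lipschitz.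
Variable R : realType.

Lemma segment_ball (E : normedModType R) (x0 a b : E) (r t : R) :
  `|a - x0| < r -> `|b - x0| < r -> 0 <= t <= 1 ->
  `|a + t *: (b - a) - x0| < r.
Proof.
move=> ar br /andP[t0 t1].
have -> : a + t *: (b - a) - x0 = (1 - t) *: (a - x0) + t *: (b - x0).
  rewrite scalerBl scale1r -[RHS]addrA (addrC (- _)) -scalerBr.
  by rewrite opprB addrA subrK addrAC.
apply: le_lt_trans (ler_normD _ _) _; rewrite !normrZ !ger0_norm ?subr_ge0//.
rewrite le_eqVlt in t0; case/orP: t0 => [/eqP<-|t0]; first by rewrite subr0 mul1r mul0r addr0.
have h1 : 0 <= (1 - t) * (r - `|a - x0|) by rewrite mulr_ge0// subr_ge0// ltW.
have h2 : 0 < t * (r - `|b - x0|) by rewrite mulr_gt0// subr_gt0.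
lra.
Qed.

(** Replaces the operator norm: by homogeneity a bound on a ball extends to all vectors, after
    rescaling v to norm r / 2. The map is a bare function so that a difference of differentials can
    be passed. *)
Lemma scalable_bound (E F : normedModType R) (l : E -> F) (r C : R) :
  0 < r -> (forall (a : R) v, l (a *: v) = a *: l v) ->
  (forall v, `|v| < r -> `|l v| <= C) -> forall v, `|l v| <= 2 * C / r * `|v|.
Proof.
move=> r0 lZ H v.
have [->|v0] := eqVneq v 0.
  by rewrite -[X in l X](scale0r 0) lZ scale0r !normr0 mulr0.
have nv : 0 < `|v| by rewrite normr_gt0.
have [a a0 av] : exists2 a : R, 0 < a & a * `|v| = r / 2.
  by exists (r / 2 / `|v|); rewrite ?divr_gt0// mulfVK ?gt_eqF.
have := H (a *: v); rewrite lZ !normrZ !(gtr0_norm a0) av => /(_ ltac:(lra)) h.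
rewrite -(ler_pM2l a0); apply: le_trans h _.
by rewrite mulrCA av le_eqVlt; apply/orP; left; apply/eqP; field; rewrite gt_eqF.
Qed.

(** Continuity of (x, v) |-> Df(x) v at the single point (x0, 0) already bounds Df uniformly near
    x0. *)
Lemma Cn1_bound (E F : normedModType R) (U : set E) (f : E -> F) (x0 : E) :
  open U -> Cn 1 U f -> U x0 ->
  exists2 K : R, 0 < K & \forall x \near x0, U x /\ forall v, `|'d f x v| <= K * `|v|.
Proof.
move=> oU [df cf] Ux0.
have := cf (x0, 0) Ux0.
move=> /cvgrPdist_lt/(_ 1 ltr01); rewrite /= linear0 => /near_norm[r r0 Hr].
exists (2 * 1 / r); first by rewrite divr_gt0// mulr1.
have Un : \forall x \near x0, U x by exact: open_nbhs_nbhs.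
have Br : \forall x \near x0, `|x - x0| < r by apply/near_norm; exists r.
apply: filterS (filterI Un Br) => x [Ux xr]; split => //.
apply: scalable_bound => //; first by move=> a v; rewrite linearZ.
move=> v vr; rewrite -normrN -[X in `|X|]sub0r ltW//; apply: (Hr (x, v)).
by rewrite prod_normE /= subr0 gt_max xr vr.
Qed.

Definition locally_lipschitz (E F : normedModType R) (f : E -> F) (x0 : E) :=
  exists2 K : R, 0 < K & exists2 r : R, 0 < r &
    forall x y, `|x - x0| < r -> `|y - x0| < r -> `|f x - f y| <= K * `|x - y|.

Lemma locally_lipschitz_continuous (E F : normedModType R) (f : E -> F) (x0 : E) :
  locally_lipschitz f x0 -> {for x0, continuous f}.
Proof.
move=> [K K0 [r r0 H]]; apply/cvgrPdist_lt => e e0.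
apply/near_norm; exists (Num.min r (e / K)); first by rewrite lt_min r0 divr_gt0.
move=> x; rewrite lt_min ltr_pdivlMr// => /andP[xr xe]; rewrite distrC.
by apply: le_lt_trans (H _ _ xr _) _; rewrite ?subrr ?normr0// mulrC.
Qed.

Lemma Cn1_lipschitz (E F : normedModType R) (U : set E) (f : E -> F) (x0 : E) :
  open U -> Cn 1 U f -> U x0 -> locally_lipschitz f x0.
Proof.
move=> oU Cf Ux0; have [K K0 /near_norm[r r0 H]] := Cn1_bound oU Cf Ux0.
exists K => //; exists r => // x y xr yr.
apply: mean_value_inequality => t t01.
have [Ut Ht] := H _ (segment_ball yr xr t01).
by split; [apply: Cf.1|exact: Ht].
Qed.

(** The map (x, v) |-> Df(x) v is itself Lipschitz near (x0, 0); comparing its values at (x, w) and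
    (y, w) for small w and rescaling w makes Df Lipschitz in operator norm. *)
Lemma Cn2_diff_lipschitz (E F : normedModType R) (U : set E) (f : E -> F) (x0 : E) :
  open U -> Cn 2 U f -> U x0 ->
  exists2 K : R, 0 < K & exists2 r : R, 0 < r & forall x y,
    `|x - x0| < r -> `|y - x0| < r -> [/\ U x, U y &
    forall v, `|'d f x v - 'd f y v| <= K * `|x - y| * `|v|].
Proof.
move=> oU [df Cf] Ux0.
have [K K0 [r r0 H]] := Cn1_lipschitz (open_fst oU) Cf (x0 := (x0, 0)) Ux0.
have /near_norm[s s0 Hs] : \forall x \near x0, U x by exact: open_nbhs_nbhs.
exists (2 * K / r); first by rewrite divr_gt0// mulr_gt0.
exists (Num.min r s); first by rewrite lt_min r0.
move=> x y; rewrite !lt_min => /andP[xr xs] /andP[yr ys].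
split; [exact: Hs|exact: Hs|move=> v].
rewrite (_ : 2 * K / r * _ = 2 * (K * `|x - y|) / r); last by ring.
apply: (scalable_bound (l := fun v => 'd f x v - 'd f y v)) => //.
  by move=> a w; rewrite scalerBr !linearZ_LR.
move=> w wr.
have := H (x, w) (y, w); rewrite !prod_normE /= subrr subr0 !gt_max xr yr wr normr0.
by rewrite (max_idPl (normr_ge0 _)); apply.
Qed.

End Lipschitz.

(** * Inverse functions *)

Section TangentProlongation.
Variable R : realType.

Lemma differentiable_id (E : normedModType R) (x : E) : differentiable id x.
Proof. by have [] := is_diff_id x. Qed.

Lemma diff_id (E : normedModType R) (x v : E) : 'd id x v = v.
Proof. by have [_ ->] := is_diff_id x. Qed.

Lemma differentiable_fst (E F : normedModType R) (p : E * F) : differentiable fst p.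
Proof. by apply: linear_differentiable => q; exact: cvg_fst. Qed.

(** The tangent map of f, for the trivial tangent bundle E x E. *)
Definition tmap (E F : normedModType R) (f : E -> F) (p : E * E) : F * F :=
  (f p.1, 'd f (p.1) p.2).

Lemma smooth_on_diff (E F : normedModType R) (U : set E) (f : E -> F) x :
  smooth_on U f -> U x -> differentiable f x.
Proof. by move=> /(_ 1) [+ _]; exact. Qed.

Lemma smooth_on_tmap (E F : normedModType R) (U : set E) (f : E -> F) :
  open U -> smooth_on U f -> smooth_on [set p : E * E | U p.1] (tmap f).
Proof.
move=> oU sf n; apply: Cn_pair; first exact: open_fst.
  apply: (@Cn_comp R n _ _ _ _ U fst f); [exact: open_fst|by []| |exact: sf].
  by apply: Cn_lin => // p; exact: cvg_fst.
by have [] := sf n.+1.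
Qed.

Section diff_tmap.
Variables (E F : normedModType R) (U : set E) (f : E -> F).
Hypotheses (oU : open U) (sf : smooth_on U f).
Let G (p : E * E) := 'd f (p.1) p.2.

Let Gdiff (p : E * E) : U p.1 -> differentiable G p.
Proof. by move=> Up; have [_ [+ _]] := sf 2; exact. Qed.

Lemma diff_tmap_vert x v k : U x -> 'd G (x, v) (0, k) = 'd f x k.
Proof.
move=> Ux.
have dj : differentiable (fun w : E => (x, w)) v.
  by apply: differentiable_pair; [exact: differentiable_cst|exact: differentiable_id].
have := @diff_comp R _ _ _ (fun w : E => (x, w)) G v dj (Gdiff (p := (x, v)) Ux).
rewrite (_ : G \o _ = 'd f x)// diff_lin; last exact/diff_continuous/smooth_on_diff.
move=> ->; rewrite /= (diff_pair (differentiable_cst x v) (differentiable_id v)).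
by rewrite (@diff_cst R E E x v) diff_id.
Qed.

(** The zero section is mapped to 0; hence the differential of [tmap f] is block diagonal at (x,
    0). *)
Lemma diff_tmap_horiz x h : U x -> 'd G (x, 0) (h, 0) = 0.
Proof.
move=> Ux.
have dj : differentiable (fun w : E => (w, 0 : E)) x.
  by apply: differentiable_pair; [exact: differentiable_id|exact: differentiable_cst].
have := @diff_comp R _ _ _ (fun w : E => (w, 0 : E)) G x dj (Gdiff (p := (x, 0)) Ux).
rewrite (_ : G \o _ = cst 0); last by apply/funext => w; rewrite /G /= linear0.
rewrite diff_cst => /(congr1 (fun u => u h)) /= e.
rewrite -[RHS]/(0 : F) [RHS]e (diff_pair (differentiable_id x) (differentiable_cst 0 x)).
by rewrite (@diff_cst R E E 0 x) diff_id.
Qed.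

(** Triangular with both diagonal blocks equal to Df(x), so the differential of [tmap f] is onto as
    soon as Df(x) is. The off-diagonal block is the second derivative. *)
Lemma diff_tmapE x v h k : U x ->
  'd (tmap f) (x, v) (h, k) = ('d f x h, 'd G (x, v) (h, 0) + 'd f x k).
Proof.
move=> Ux; have df := smooth_on_diff sf Ux.
have df1 : differentiable (f \o fst) (x, v).
  by apply: differentiable_comp => //; exact: differentiable_fst.
rewrite diff_pair//; last exact: Gdiff.
have dfst : differentiable fst (x, v : E) by exact: differentiable_fst.
rewrite (diff_comp dfst df) /=.
rewrite (@diff_lin R _ _ fst) //; last by move=> p; exact: cvg_fst.
rewrite -(diff_tmap_vert v k Ux) -linearD; congr (_, 'd G _ _).
by rewrite /= -[RHS]/(h + 0, 0 + k) addr0 add0r.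
Qed.

End diff_tmap.
End TangentProlongation.

Section InverseSmooth.
Variable R : realType.

Lemma bounded_linear_cont (E F : normedModType R) (l : {linear E -> F}) (K : R) :
  (forall v, `|l v| <= K * `|v|) -> continuous l.
Proof.
move=> lK; apply/linear_bounded_continuous/ex_bound.
exists (`|K|); apply/near_norm; exists 1 => // v; rewrite subr0 => v1.
apply: le_trans (lK v) _; apply: le_trans (ler_norm _) _.
by rewrite normrM normr_id ler_piMr// ltW.
Qed.

(** The Lipschitz bound on g bounds Df from below; this gives both injectivity of Df and continuity
    of its inverse, with no appeal to the open mapping theorem. *)
Lemma inverse_differentiable (E F : normedModType R) (f : E -> F) (g : F -> E)
    (y0 : F) (K : R) :
  0 < K -> differentiable f (g y0) ->
  (forall w, exists v, 'd f (g y0) v = w) ->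
  (\forall x \near g y0, g (f x) = x) -> (\forall y \near y0, f (g y) = y) ->
  (\forall y \near y0, `|g y - g y0| <= K * `|y - y0|) ->
  [/\ differentiable g y0, forall w, 'd f (g y0) ('d g y0 w) = w,
      forall v, 'd g y0 ('d f (g y0) v) = v &
      forall w, `|'d g y0 w| <= 2 * K * `|w|].
Proof.
set x0 := g y0 => K0 df surj gfK fgK glip.
have fx0 : f x0 = y0 by exact: nbhs_singleton fgK.
have fc : {for x0, continuous f} by exact: differentiable_continuous.
(* Compare g (f (x0 + t v)) = x0 + t v with the linearization of f: an error of (2 K)^-1 t |v| in f
   costs, after the factor K, only half of t |v|. *)
have low v : `|v| <= 2 * K * `|'d f x0 v|.
  have e0 : 0 < (2 * K)^-1 by rewrite invr_gt0 mulr_gt0.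
  have glip' : \forall x \near x0, `|g (f x) - x0| <= K * `|f x - y0|.
    have fc' : f x @[x --> x0] --> y0 by rewrite -[X in _ --> X]fx0; exact: fc.
    exact: (fc' _ glip).
  have /near_norm[r r0 Hr] := diff_cvg df e0.
  have [s s0 [_ Hs]] := near_normI r0 gfK glip'.
  have m0 : 0 < `|v| + 1 by rewrite ltr_wpDl.
  pose t := Num.min r s / 2 / (`|v| + 1).
  have rs0 : 0 < Num.min r s by rewrite lt_min r0.
  have t0 : 0 < t by rewrite !divr_gt0.
  have tv : t * `|v| < Num.min r s.
    apply: le_lt_trans (_ : t * (`|v| + 1) < _).
      by rewrite ler_wpM2l ?lerDl// ltW.
    by rewrite /t mulfVK ?gt_eqF//; lra.
  clearbody t.
  have := Hr (t *: v); rewrite subr0 linearZ_LR !normrZ !(gtr0_norm t0).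
  move: tv; rewrite lt_min => /andP[tr ts] /(_ tr) h1.
  have [h2 h3] : g (f (t *: v + x0)) = t *: v + x0 /\
      `|g (f (t *: v + x0)) - x0| <= K * `|f (t *: v + x0) - y0|.
    by apply: Hs; rewrite addrK normrZ gtr0_norm.
  move: h3; rewrite h2 addrK normrZ gtr0_norm// -fx0 => h3.
  have h4 : `|f (t *: v + x0) - f x0| <= (2 * K)^-1 * (t * `|v|) + t * `|'d f x0 v|.
    rewrite -[f _ - f x0](subrK (t *: 'd f x0 v)).
    apply: le_trans (ler_normD _ _) _; rewrite lerD//.
    by rewrite normrZ gtr0_norm.
  rewrite -(ler_pM2l t0).
  have h5 := le_trans h3 (ler_wpM2l (ltW K0) h4).
  have h6 : K * ((2 * K)^-1 * (t * `|v|)) = t * `|v| / 2.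
    by field; rewrite gt_eqF.
  rewrite mulrDr h6 in h5; lra.
have inj v v' : 'd f x0 v = 'd f x0 v' -> v = v'.
  move=> e; apply/eqP; rewrite -subr_eq0 -normr_le0.
  by apply: le_trans (low _) _; rewrite linearB /= e subrr normr0 mulr0.
have [h hK] := choice surj.
have hlin : linear h by move=> a u v; apply: inj; rewrite hK linearP !hK.
pose H : {linear F -> E} := HB.pack h (GRing.isLinear.Build R F E _ h hlin).
have Hb w : `|H w| <= 2 * K * `|w| by rewrite -[X in _ * `|X|]hK; exact: low.
have [|dg dgE] := @diff_cvgE R F E g H y0 (bounded_linear_cont Hb).
  move=> e e0.
  have e'0 : 0 < e / (2 * K * K) by rewrite divr_gt0// !mulr_gt0.
  have gc : {for y0, continuous g}.
    apply/cvgrPdist_lt => d d0; have /near_norm[r r0 Hr] := glip.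
    apply/near_norm; exists (Num.min r (d / K)); first by rewrite lt_min r0 divr_gt0.
    move=> y; rewrite lt_min ltr_pdivlMr// => /andP[yr yd]; rewrite distrC.
    by apply: le_lt_trans (Hr _ yr) _; rewrite mulrC.
  have s0 : (shift y0) k @[k --> (0 : F)] --> y0.
    rewrite -[X in _ --> X]add0r; apply: cvgD; [exact: cvg_id|exact: cvg_cst].
  have D := diff_cvg df e'0.
  have gs : g (k + y0) - x0 @[k --> (0 : F)] --> (0 : E).
    rewrite -(subrr x0); apply: cvgB; last exact: cvg_cst.
    exact: (cvg_comp _ _ s0 gc).
  have D' : \forall k \near (0 : F), `|f (g (k + y0) - x0 + x0) - f x0 -
      'd f x0 (g (k + y0) - x0)| <= e / (2 * K * K) * `|g (k + y0) - x0|.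
    exact: (gs _ D).
  have near1 : \forall k \near (0 : F), f (g (k + y0)) = k + y0 by exact: (s0 _ fgK).
  have near2 : \forall k \near (0 : F), `|g (k + y0) - x0| <= K * `|k + y0 - y0|.
    exact: (s0 _ glip).
  apply: filterS3 D' near1 near2 => k /= h1 h2 h3; move: h1; rewrite subrK h2 fx0 addrK => h1; rewrite addrK in h3.
  (* D0 is the increment of g, and k - Df(D0) is the remainder of f at D0. The inverse differential
     maps it to h k - D0, and |D0| <= K |k| makes this o(k). *)
  set D0 := g (k + y0) - x0 in h1 h3 *.
  have -> : D0 - h k = - H (k - 'd f x0 D0).
    rewrite linearB opprB /=; congr (_ - _); apply: inj; by rewrite hK.
  rewrite normrN; apply: le_trans (Hb _) _.
  apply: le_trans (ler_wpM2l _ h1) _; first by rewrite ltW// mulr_gt0.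
  apply: le_trans (_ : 2 * K * (e / (2 * K * K) * (K * `|k|)) <= _).
    by rewrite !ler_wpM2l// ltW// mulr_gt0.
  rewrite le_eqVlt; apply/orP; left; apply/eqP; field.
  by rewrite gt_eqF.
have dgH w : 'd g y0 w = h w by rewrite dgE.
by split => // [w|v|w]; rewrite dgH; [exact: hK|apply: inj; exact: hK|exact: Hb].
Qed.

(** Induction with varying spaces: [tmap g] is the inverse of [tmap f], and C^n for [tmap g] gives
    C^(n+1) for g. Surjectivity of Df and the Lipschitz bound on g are hypotheses in a form that
    passes on to the tangent maps. *)
Lemma Cn_inverse n (E F : normedModType R) (U : set E) (V : set F)
    (f : E -> F) (g : F -> E) :
  open U -> open V -> smooth_on U f ->
  (forall x, U x -> V (f x)) -> (forall y, V y -> U (g y)) ->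
  (forall x, U x -> g (f x) = x) -> (forall y, V y -> f (g y) = y) ->
  (forall x, U x -> forall w, exists v, 'd f x v = w) ->
  (forall y, V y -> locally_lipschitz g y) ->
  Cn n V g.
Proof.
elim: n E F U V f g => [|n IH] E F U V f g oU oV sf fUV gVU gK fK surj glip.
  by move=> y Vy; apply: locally_lipschitz_continuous; exact: glip.
have gc y : V y -> {for y, continuous g}.
  by move=> /glip; exact: locally_lipschitz_continuous.
have gD y0 (K r : R) : V y0 -> 0 < K -> 0 < r -> (forall x y, `|x - y0| < r ->
      `|y - y0| < r -> `|g x - g y| <= K * `|x - y|) ->
    forall y, V y -> `|y - y0| < r ->
    [/\ differentiable g y, forall w, 'd f (g y) ('d g y w) = w,
      forall v, 'd g y ('d f (g y) v) = v & forall w, `|'d g y w| <= 2 * K * `|w|].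
  move=> Vy0 K0 r0 gKr y Vy yr; have Ugy := gVU _ Vy.
  apply: inverse_differentiable => //.
  - exact: smooth_on_diff sf Ugy.
  - exact: surj.
  - have : \forall x \near g y, U x by exact: open_nbhs_nbhs.
    by apply: filterS => x; exact: gK.
  - have : \forall x \near y, V x by exact: open_nbhs_nbhs.
    by apply: filterS => x; exact: fK.
  - apply/near_norm; exists (r - `|y - y0|); first by rewrite subr_gt0.
    move=> z; rewrite ltrBrDr => zy; apply: gKr => //.
    by apply: le_lt_trans (ler_distD y z y0) _.
have gD0 y0 : V y0 -> [/\ differentiable g y0, forall w, 'd f (g y0) ('d g y0 w) = w
    & forall v, 'd g y0 ('d f (g y0) v) = v].
  move=> Vy0; have [K K0 [r r0 H]] := glip _ Vy0.
  by have [] := gD _ _ _ Vy0 K0 r0 H y0 Vy0 _; rewrite ?subrr ?normr0.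
split; first by move=> y /gD0[].
suff H : Cn n [set p : F * F | V p.1] (tmap g).
  apply: (@Cn_comp R n _ _ _ [set p : F * F | V p.1] setT (tmap g) snd) => //.
    exact: open_fst.
  by apply: Cn_lin => // p; exact: cvg_snd.
apply: (IH _ _ [set p : E * E | U p.1] _ (tmap f)).
- exact: open_fst.
- exact: open_fst.
- exact: smooth_on_tmap.
- by move=> p; exact: fUV.
- by move=> p; exact: gVU.
- move=> [x v] Ux; rewrite /tmap /= gK//.
  have [_ _] := gD0 _ (fUV _ Ux); rewrite gK// => ->//.
- move=> [y w] Vy; rewrite /tmap /= fK//.
  by have [_ -> _] := gD0 _ Vy.
(* Solve the triangular system: first the base component h, then k. *)
- move=> [x v] Ux [a c].
  have [h hE] := surj _ Ux a.
  have [k kE] := surj _ Ux (c - 'd (fun p : E * E => 'd f (p.1) p.2) (x, v) (h, 0)).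
  by exists (h, k); rewrite (diff_tmapE sf)// hE kE addrC subrK.
- move=> [y0 w0] /= Vy0.
  have [K K0 [r r0 gKr]] := glip _ Vy0.
  have [K2 K20 [s s0 H2]] := Cn2_diff_lipschitz oU (sf 2) (gVU _ Vy0).
  have N1 : \forall y \near y0, V y by exact: open_nbhs_nbhs.
  have N2 : \forall y \near y0, `|g y - g y0| < s.
    have /cvgrPdist_lt/(_ s s0) := gc _ Vy0.
    by apply: filterS => y; rewrite distrC.
  have [t t0 [tr Ht]] := near_normI r0 N1 N2.
  pose W := `|w0| + 1.
  have W0 : 0 < W by rewrite ltr_wpDl.
  (* K accounts for g itself, 2 K for the change of w, and the last term for the change of Dg,
     through Dg(y) - Dg(y') = Dg(y) (Df(g y') - Df(g y)) Dg(y'). *)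
  pose L := K + 2 * K + 2 * K * (K2 * K * (2 * K * W)).
  have L0 : 0 < L by rewrite !addr_gt0// !mulr_gt0.
  exists L => //; exists (Num.min t 1); first by rewrite lt_min t0 ltr01.
  move=> [y w] [y' w']; rewrite !prod_normE /= !gt_max !lt_min.
  move=> /andP[/andP[yt _] _] /andP[/andP[y't _] /andP[_ w'1]].
  have [Vy gys] := Ht _ yt; have [Vy' gy's] := Ht _ y't.
  have yr := lt_le_trans yt tr; have y'r := lt_le_trans y't tr.
  have [_ _ gy1 gy2] := gD _ _ _ Vy0 K0 r0 gKr _ Vy yr.
  have [_ gy'1 _ gy'2] := gD _ _ _ Vy0 K0 r0 gKr _ Vy' y'r.
  have w'W : `|w'| <= W.
    by have := ler_normD (w' - w0) w0; rewrite subrK /W; lra.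
  set m := Num.max `|y - y'| `|w - w'|.
  have ym : `|y - y'| <= m by rewrite le_max lexx.
  have wm : `|w - w'| <= m by rewrite le_max lexx orbT.
  have m0 : 0 <= m := le_trans (normr_ge0 _) ym.
  have KK0 : 0 <= 2 * K by rewrite ltW// mulr_gt0.
  have R0 : 0 <= 2 * K * (K2 * K * (2 * K * W)) * m.
    by apply: mulr_ge0 => //; rewrite ltW// !mulr_gt0.
  have Km0 : 0 <= K * m by rewrite mulr_ge0// ltW.
  rewrite ge_max; apply/andP; split.
    apply: le_trans (gKr _ _ yr y'r) _.
    apply: le_trans (ler_wpM2l (ltW K0) ym) _.
    rewrite /L !mulrDl; lra.
  pose u := 'd g y' w'.
  have uW : `|u| <= 2 * K * W by apply: le_trans (gy'2 _) _; rewrite ler_wpM2l.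
  have -> : 'd g y w - 'd g y' w' =
      'd g y (w - w') + 'd g y ('d f (g y') u - 'd f (g y) u).
    by rewrite !linearB /= gy1 gy'1 addrA subrK.
  apply: le_trans (ler_normD _ _) _.
  have h1 : `|'d g y (w - w')| <= 2 * K * m.
    by apply: le_trans (gy2 _) _; rewrite ler_wpM2l.
  have h2 : `|'d g y ('d f (g y') u - 'd f (g y) u)| <=
      2 * K * (K2 * K * (2 * K * W)) * m.
    apply: le_trans (gy2 _) _; rewrite -[X in _ <= X]mulrA ler_wpM2l//.
    have [_ _ /(_ u) H3] := H2 _ _ gy's gys.
    apply: le_trans H3 _.
    have gyy : `|g y' - g y| <= K * m.
      by rewrite distrC; apply: le_trans (gKr _ _ yr y'r) _; rewrite ler_wpM2l// ltW.
    apply: le_trans (_ : K2 * (K * m) * (2 * K * W) <= _).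
      apply: ler_pM uW => //; first by rewrite mulr_ge0// ltW.
      by rewrite ler_wpM2l// ltW.
    by rewrite le_eqVlt; apply/orP; left; apply/eqP; ring.
  rewrite /L !mulrDl; lra.
Qed.

End InverseSmooth.

(** * The inverse function theorem at a point where the derivative is the identity *)

Section InverseFunction.
Variable R : realType.

Lemma subrACA (V : zmodType) (x y z w : V) : x - y - (z - w) = x - z - (y - w).
Proof. by rewrite !opprB addrACA [RHS]addrACA [- y - _]addrC. Qed.

(** A solution of f x = y is a fixed point of x |-> y - (f x - x), a contraction with ratio 1/2. *)
Lemma near_identity_surjective (E : completeNormedModType R) (f : E -> E)
    (x0 : E) (r : R) :
  (forall x y, `|x - x0| < r -> `|y - x0| < r ->
     `|(f x - x) - (f y - y)| <= 2^-1 * `|x - y|) ->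
  forall y, `|y - f x0| < r / 2 -> exists2 x, `|x - x0| < r & f x = y.
Proof.
move=> H y yr.
(* With this radius T maps the closed ball into itself: the defect y - f x0 and the contraction
   contribute at most s / 2 each. Moreover s < r. *)
pose s := 2 * `|y - f x0|.
have sr : s < r by rewrite /s; lra.
have s0 : 0 <= s by rewrite mulr_ge0.
pose B := [set x : E | `|x0 - x| <= s].
pose T x := y - (f x - x).
have Bx x : B x -> `|x - x0| < r by rewrite /B /= distrC => /le_lt_trans; apply.
have Bx0 : B x0 by rewrite /B /= subrr normr0.
have x0r : `|x0 - x0| < r by exact: Bx.
have TB : {homo T : x / B x}.
  move=> x Bxx; have := H _ _ (Bx _ Bxx) x0r; move: Bxx; rewrite /B /= distrC => Bxx h.
  rewrite distrC (_ : T x - x0 = (y - f x0) - ((f x - x) - (f x0 - x0))).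
    apply: le_trans (ler_normB _ _) _; rewrite /s in Bxx *; lra.
  by rewrite opprB [RHS]addrA subrKA /T addrAC.
pose TT : {fun B >-> B} := HB.pack T (isFun.Build E E B B T TB).
have q0 : (0 : R) <= 2^-1 by rewrite invr_ge0.
have ctr : is_contraction TT.
  exists (NngNum q0); split; first by rewrite /= invf_lt1// ltr1n.
  move=> [a b] [/= Ba Bb]; have := H _ _ (Bx _ Ba) (Bx _ Bb).
  suff -> : TT (a, b).1 - TT (a, b).2 = - ((f a - a) - (f b - b)) by rewrite normrN.
  by rewrite /= /T; move: (f a - a) (f b - b) => P Q; rewrite !opprB addrC subrKA.
have clB : closed B by exact: closed_closed_ball_.
have [x Bxx xE] := banach_fixed_point ctr clB (ex_intro _ _ Bx0).
exists x; first exact: Bx.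
have /= := congr1 (fun z => z + (f x - x)) xE.
by rewrite /T subrK addrC subrK.
Qed.

(** The contraction estimate holds on all of E, so a ball of radius above 2 |w| around 0 suffices to
    reach w. *)
Lemma near_identity_additive_surjective (E : completeNormedModType R) (l : E -> E) :
  (forall a b, l (a - b) = l a - l b) -> (forall v, `|l v - v| <= 2^-1 * `|v|) ->
  forall w, exists v, l v = w.
Proof.
move=> lB lv w.
have [||v _ vw] := @near_identity_surjective E l 0 (2 * `|w| + 1) _ w.
- by move=> a b _ _; rewrite subrACA -lB.
- by rewrite -(subrr 0) lB subrr subr0; lra.
- by exists v.
Qed.

Definition diffeo (E F : normedModType R) (U : set E) (V : set F)
    (f : E -> F) (g : F -> E) : Prop :=
  [/\ open U, open V, smooth_on U f & smooth_on V g] /\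
  [/\ forall x, U x -> V (f x), forall y, V y -> U (g y),
      forall x, U x -> g (f x) = x & forall y, V y -> f (g y) = y].

Lemma near_identity_bounds (E : normedModType R) (U : set E) (f : E -> E) (x0 : E) :
  open U -> smooth_on U f -> U x0 -> (forall v, 'd f x0 v = v) ->
  exists2 r : R, 0 < r &
    [/\ forall x, `|x - x0| < r -> U x,
        forall x v, `|x - x0| < r -> `|'d f x v - v| <= 2^-1 * `|v| &
        forall x y, `|x - x0| < r -> `|y - x0| < r ->
          `|(f x - x) - (f y - y)| <= 2^-1 * `|x - y|].
Proof.
move=> oU sf Ux0 dfx0.
have [K K0 [s s0 H]] := Cn2_diff_lipschitz oU (sf 2) Ux0.
(* K r <= 1/2 gives the contraction ratio. *)
pose r := Num.min s (2 * K)^-1.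
have r0 : 0 < r by rewrite lt_min s0 invr_gt0 mulr_gt0.
have rs x : `|x - x0| < r -> `|x - x0| < s by rewrite lt_min => /andP[].
have x0s : `|x0 - x0| < s by rewrite subrr normr0.
have dv x v : `|x - x0| < r -> `|'d f x v - v| <= 2^-1 * `|v|.
  move=> xr; have [_ _ /(_ v)] := H _ _ (rs _ xr) x0s; rewrite dfx0.
  move=> /le_trans; apply; rewrite ler_wpM2r//.
  move: xr; rewrite lt_min => /andP[_ /ltW /(ler_wpM2l (ltW K0))/le_trans]; apply.
  by rewrite le_eqVlt; apply/orP; left; apply/eqP; field; rewrite gt_eqF.
have rU x : `|x - x0| < r -> U x by move=> /rs xs; have [] := H _ _ xs x0s.
exists r => //; split => // x y xr yr.
apply: (mean_value_inequality (f := fun z => f z - z)) => t t01.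
have zr := segment_ball yr xr t01.
have df := smooth_on_diff sf (rU _ zr).
have did := differentiable_id (y + t *: (x - y)).
split; first exact: differentiableB.
by rewrite (diffB df did) /= diff_id; exact: dv.
Qed.

Lemma inverse_function_id (E : completeNormedModType R) (U : set E) (f : E -> E)
    (x0 : E) :
  open U -> smooth_on U f -> U x0 -> (forall v, 'd f x0 v = v) ->
  exists (W V : set E) (g : E -> E), [/\ W x0, W `<=` U & diffeo W V f g].
Proof.
move=> oU sf Ux0 dfx0.
have [r r0 [rU rd rf]] := near_identity_bounds oU sf Ux0 dfx0.
pose W := [set x | `|x - x0| < r /\ `|f x - f x0| < r / 2].
pose V := [set y | `|y - f x0| < r / 2].
have surjf := near_identity_surjective rf.
(* Off V the value x0 is a mere default. *)
have /choice[g gP] : forall y, exists x, V y -> `|x - x0| < r /\ f x = y.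
  move=> y; have [/surjf[x xr xy]|] := pselect (V y); last by exists x0.
  by exists x.
(* This lower bound makes f injective on the ball and provides the Lipschitz constant 2 of g that
   [Cn_inverse] asks for. *)
have lowf x y : `|x - x0| < r -> `|y - x0| < r -> `|x - y| <= 2 * `|f x - f y|.
  move=> xr yr; have := rf _ _ xr yr.
  have -> : f x - x - (f y - y) = (f x - f y) - (x - y).
    by rewrite subrACA.
  by have := ler_distD (f x - f y) (x - y) 0; rewrite !subr0 [`|x - y - _|]distrC; lra.
have oV : open V.
  rewrite openE => y Vy; apply/near_norm; exists (r / 2 - `|y - f x0|).
    by rewrite subr_gt0.
  by move=> z; rewrite ltrBrDr; apply: le_lt_trans; exact: ler_distD.
have oW : open W.
  rewrite openE => x [xr fxr].
  have fx : {for x, continuous f}.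
    by apply/differentiable_continuous/(smooth_on_diff sf)/rU.
  have N1 : \forall z \near x, `|z - x0| < r.
    apply/near_norm; exists (r - `|x - x0|); first by rewrite subr_gt0.
    by move=> z; rewrite ltrBrDr; apply: le_lt_trans; exact: ler_distD.
  have N2 : \forall z \near x, V (f z) by apply: fx; exact: open_nbhs_nbhs.
  by apply: filterS2 N1 N2 => z.
exists W, V, g; split => //.
- by split; rewrite subrr normr0// divr_gt0.
- by move=> x [/rU].
have gV y : V y -> W (g y).
  by move=> Vy; have [gr fg] := gP _ Vy; split; rewrite ?fg.
have gK x : W x -> g (f x) = x.
  move=> [xr Vfx]; have [gr fg] := gP _ Vfx.
  apply/eqP; rewrite -subr_eq0 -normr_le0.
  by apply: le_trans (lowf _ _ gr xr) _; rewrite fg subrr normr0 mulr0.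
have fK y : V y -> f (g y) = y by move=> /gP[].
have sW : smooth_on W f by move=> n; apply: Cn_sub (sf n) => x [/rU].
split; split => //; last by move=> x [].
move=> n; apply: (Cn_inverse _ oW oV sW) => //; first by move=> x [].
  move=> x [xr _] w.
  apply: (near_identity_additive_surjective (l := 'd f x)) => [a b|v].
    by rewrite linearB.
  exact: rd.
move=> y Vy; exists 2 => //; have /near_norm[s s0 sV] := open_nbhs_nbhs (conj oV Vy).
exists s => // a b /sV Va /sV Vb.
have [ar ab] := gP _ Va; have [br bb] := gP _ Vb.
by have := lowf _ _ ar br; rewrite ab bb.
Qed.

End InverseFunction.

(** * The Koenigs limit of a contraction with derivative 1/2 *)

Section Scaling.
Variable R : realType.

Lemma Cn_scale n (E F : normedModType R) (U : set E) (f : E -> F) (c : R) :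
  open U -> Cn n U f -> Cn n U (fun x => c *: f x).
Proof.
move=> oU Cf; apply: (@Cn_comp R n _ _ _ U setT f ( *:%R c)) => //.
by apply: Cn_lin; [move=> a u v; rewrite scalerDr !scalerA mulrC|exact: scaler_continuous].
Qed.

Lemma inverse_function_scale (E : completeNormedModType R) (U : set E)
    (f : E -> E) (x0 : E) (c : R) :
  c != 0 -> open U -> smooth_on U f -> U x0 -> (forall v, 'd f x0 v = c *: v) ->
  exists (W V : set E) (g : E -> E), [/\ W x0, W `<=` U & diffeo W V f g].
Proof.
move=> c0 oU sf Ux0 dfx0; pose h x := c^-1 *: f x.
have df := smooth_on_diff sf Ux0.
have [|v|W [V [g [Wx0 WU [[oW oV sh sg] [WV VW gK hK]]]]]] :=
    @inverse_function_id R E U h x0 oU _ Ux0.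
- by move=> n; exact: Cn_scale.
- by rewrite (diffZ _ df) /= dfx0 scalerA mulVf// scale1r.
have cl : linear ( *:%R c^-1 : E -> E).
  by move=> a u v; rewrite scalerDr !scalerA mulrC.
have cc : continuous ( *:%R c^-1 : E -> E) by exact: scaler_continuous.
have oV' : open [set y | V (c^-1 *: y)] by apply: open_comp => // y _; exact: cc.
exists W, [set y | V (c^-1 *: y)], (g \o *:%R c^-1); split => //.
split; split => //=.
- by move=> n; apply: Cn_sub (sf n).
- by move=> n; apply: (@Cn_comp R n _ _ _ _ V) (sg n) => //; exact: Cn_lin.
- by move=> y /VW.
- by move=> y /hK /(congr1 ( *:%R c)); rewrite /h !scalerA mulfV// !scale1r.
Qed.

Lemma diffeo_diffK (E F : normedModType R) (U : set E) (V : set F) f g x v w :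
  diffeo U V f g -> U x -> 'd f x v = w -> 'd g (f x) w = v.
Proof.
move=> [[oU oV sf sg] [UV VU gK fK]] Ux <-.
have df := smooth_on_diff sf Ux; have dg := smooth_on_diff sg (UV _ Ux).
have := @diff_comp R _ _ _ f g x df dg => /(congr1 (fun u => u v)) /= <-.
have [|_ ->] := @diff_congr R E E id (g \o f) x _ (differentiable_id x).
  have : \forall y \near x, U y by exact: open_nbhs_nbhs.
  by apply: filterS => y Uy /=; rewrite gK.
exact: diff_id.
Qed.

Lemma expr_lt (q e : R) : 0 <= q < 1 -> 0 < e -> exists n, q ^+ n < e.
Proof.
move=> /andP[q0 q1] e0.
have := @cvg_expr R q; rewrite ger0_norm// => /(_ q1) /cvgrPdist_lt /(_ e e0) [N _ H].
by exists N; have := H N (leqnn N); rewrite /= sub0r normrN ger0_norm// exprn_ge0.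
Qed.

Section geometric.
Variables (E : normedModType R) (u : nat -> E) (C q : R).
Hypotheses (q01 : 0 <= q < 1) (uC : forall k, `|u k.+1 - u k| <= C * q ^+ k).

Lemma geometric_dist n m : `|u (n + m)%N - u n| <= C / (1 - q) * q ^+ n.
Proof.
have /andP[q0 q1] := q01.
have C0 : 0 <= C by have := uC 0; rewrite expr0 mulr1; apply: le_trans.
(* The factor 1 - q^m keeps the exact partial geometric sum, which the induction on m needs. *)
suff : `|u (n + m)%N - u n| <= C / (1 - q) * q ^+ n * (1 - q ^+ m).
  move=> /le_trans; apply; rewrite ler_piMr//.
    by rewrite !mulr_ge0 ?invr_ge0 ?exprn_ge0// subr_ge0 ltW.
  by rewrite lerBlDr lerDl exprn_ge0.
elim: m => [|m IH]; first by rewrite addn0 expr0 !subrr normr0 mulr0.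
rewrite addnS; apply: le_trans (ler_distD (u (n + m)%N) _ _) _.
apply: le_trans (lerD (uC _) IH) _.
rewrite le_eqVlt; apply/orP; left; apply/eqP; rewrite exprD exprS; field.
by rewrite subr_eq0 eq_sym lt_eqF.
Qed.

Lemma geometric_limit_dist (l : E) n :
  u k @[k --> \oo] --> l -> `|l - u n| <= C / (1 - q) * q ^+ n.
Proof.
move=> ul; apply/ler_addgt0Pr => e e0.
have /cvgrPdist_lt/(_ e e0)[N _ H] := ul.
have h := H (n + N)%N (leq_addl _ _).
apply: le_trans (ler_distD (u (n + N)%N) _ _) _.
by rewrite addrC lerD//; [exact: geometric_dist|exact: ltW].
Qed.

End geometric.

Lemma geometric_cvg (E : completeNormedModType R) (u : nat -> E) (C q : R) :
  0 <= q < 1 -> (forall k, `|u k.+1 - u k| <= C * q ^+ k) -> cvgn u.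
Proof.
move=> q01 uC; apply/cauchy_cvgP; apply: cauchy_exP => e e0.
have /andP[q0 q1] := q01.
have C0 : 0 <= C by have := uC 0; rewrite expr0 mulr1; apply: le_trans.
pose C' := C / (1 - q) + 1.
have C'0 : 0 < C' by rewrite ltr_wpDl// mulr_ge0 ?invr_ge0// subr_ge0 ltW.
have [n qn] := expr_lt q01 (divr_gt0 e0 C'0).
exists (u n); exists n => // m /= nm; rewrite -ball_normE /= distrC -(subnKC nm).
apply: le_lt_trans (geometric_dist q01 uC n (m - n)) _.
rewrite ltr_pdivlMr// in qn; apply: le_lt_trans qn.
by rewrite mulrC ler_wpM2l ?exprn_ge0// lerDl.
Qed.

End Scaling.

(** * Basins of contracting germs, and their tangent prolongations *)

Section HalfBasin.
Variable R : realType.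

Definition half_germ (E : normedModType R) (U : set E) (g : E -> E) : Prop :=
  [/\ open U, smooth_on U g, U 0, g 0 = 0 & forall v, 'd g 0 v = 2^-1 *: v].

(** Attraction is asked pointwise, without uniformity, because the condition has to pass to [tmap g]
    on U x E, whose fibres are unbounded. *)
Definition half_basin (E : normedModType R) (U : set E) (g : E -> E) : Prop :=
  half_germ U g /\
  (forall x, U x -> U (g x)) /\
  (forall x (e : R), U x -> 0 < e -> exists m, `|iter m g x| < e).

Definition kseq (E : normedModType R) (g : E -> E) (k : nat) (x : E) : E :=
  2 ^+ k *: iter k g x.

(** The k-th increment of [kseq] is 2^k (2 g - id) at the k-th iterate. As D(2 g - id) vanishes at
    0, the Lipschitz constant of 2 g - id on the ball of radius (2/3)^k r is O((2/3)^k), and the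
    iterates contract by (2/3)^k once more; finally 2 (2/3)^2 = 8/9 < 1. *)
Lemma half_germ_bound (E : normedModType R) (U : set E) (g : E -> E) :
  half_germ U g -> exists2 r : R, 0 < r &
  [/\ forall x, `|x| < r -> U x,
      forall (x v : E), `|x| < r -> `|'d g x v| <= 2 / 3 * `|v|,
      forall x y, `|x| < r -> `|y| < r -> `|g x - g y| <= 2 / 3 * `|x - y| &
      forall x y k, `|x| < r -> `|y| < r ->
        `|kseq g k.+1 x - kseq g k x - (kseq g k.+1 y - kseq g k y)| <=
        `|x - y| * (8 / 9) ^+ k].
Proof.
move=> [oU sg U0 g0 dg0].
have [K K0 [s s0 H]] := Cn2_diff_lipschitz oU (sg 2) U0.
(* K r <= 1/6 = 2/3 - 1/2 turns the derivative 1/2 at 0 into the contraction rate 2/3 on the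
   ball. *)
pose r := Num.min s (6 * K)^-1.
have r0 : 0 < r by rewrite lt_min s0 invr_gt0 mulr_gt0.
have rs (x : E) : `|x| < r -> `|x - 0| < s by rewrite subr0 lt_min => /andP[].
have rU (x : E) : `|x| < r -> U x by move=> /rs xs; have [] := H _ _ xs xs.
have z0 : `|0 - 0 : E| < s by rewrite subrr normr0.
have Kr : K * r <= 6^-1.
  have : r <= (6 * K)^-1 by rewrite ge_min lexx orbT.
  move=> /(ler_wpM2l (ltW K0))/le_trans; apply.
  by rewrite le_eqVlt; apply/orP; left; apply/eqP; field; rewrite gt_eqF.
have dg (x v : E) : `|x| < r -> `|'d g x v - 2^-1 *: v| <= K * `|x| * `|v|.
  by move=> xr; have [_ _ /(_ v)] := H _ _ (rs _ xr) z0; rewrite dg0 subr0.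
have dg' (x v : E) : `|x| < r -> `|'d g x v| <= 2 / 3 * `|v|.
  move=> xr; have := dg _ v xr.
  have h1 : K * `|x| * `|v| <= 6^-1 * `|v|.
    by rewrite ler_wpM2r//; apply: le_trans Kr; rewrite ler_wpM2l// ltW.
  have := ler_distD (2^-1 *: v) ('d g x v) 0; rewrite !subr0 normrZ gtr0_norm//.
  lra.
have seg (x y : E) (t rho : R) : `|x| < rho -> `|y| < rho -> 0 <= t <= 1 ->
    `|y + t *: (x - y)| < rho.
  by move=> xr yr t01; have := @segment_ball R E 0 y x rho t; rewrite !subr0; exact.
have gl (x y : E) : `|x| < r -> `|y| < r -> `|g x - g y| <= 2 / 3 * `|x - y|.
  move=> xr yr; apply: mean_value_inequality => t t01.
  have zr := seg _ _ _ _ xr yr t01.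
  by split; [exact/(smooth_on_diff sg)/rU|exact: dg'].
have hl (rho : R) (x y : E) : rho <= r -> `|x| < rho -> `|y| < rho ->
    `|(2 *: g x - x) - (2 *: g y - y)| <= 2 * (K * rho * `|x - y|).
  move=> rr xr yr; apply: (mean_value_inequality (f := fun z => 2 *: g z - z)) => t t01.
  have zr := seg _ _ _ _ xr yr t01; have zr' := lt_le_trans zr rr.
  have dgz := smooth_on_diff sg (rU _ zr').
  have did := differentiable_id (y + t *: (x - y)).
  have dsc := differentiableZ 2 dgz.
  split; first exact: differentiableB.
  rewrite (diffB dsc did) /= diff_id (diffZ 2 dgz) /=.
  set w := x - y; set z := y + _.
  rewrite (_ : 2 *: 'd g z w - w = 2 *: ('d g z w - 2^-1 *: w)); last first.
    by rewrite scalerBr scalerA mulfV// scale1r.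
  rewrite normrZ gtr0_norm// ler_wpM2l//; apply: le_trans (dg _ _ zr') _.
  by rewrite ler_wpM2r// ler_wpM2l// ltW.
have il k (x y : E) : `|x| < r -> `|y| < r ->
    [/\ `|iter k g x| < (2 / 3) ^+ k * r, `|iter k g x| < r &
    `|iter k g x - iter k g y| <= (2 / 3) ^+ k * `|x - y|].
  have w k' (z : E) : `|z| < (2 / 3) ^+ k' * r -> `|z| < r.
    move=> /lt_le_trans; apply; rewrite ler_piMl ?(ltW r0)// exprn_ile1//; lra.
  suff P (a b : E) : `|a| < r -> `|b| < r -> `|iter k g a| < (2 / 3) ^+ k * r /\
    `|iter k g a - iter k g b| <= (2 / 3) ^+ k * `|a - b|.
    by move=> xr yr; have [P1 P2] := P _ _ xr yr; split => //; exact: w P1.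
  elim: k a b => [|k IH] a b ar br /=; first by rewrite expr0 !mul1r.
  have [A1 A2] := IH _ _ ar br; have [B1 _] := IH _ _ br ar.
  have z0r : `|0 : E| < r by rewrite normr0.
  split.
    have := gl _ _ (w _ _ A1) z0r; rewrite g0 !subr0 => /le_lt_trans; apply.
    by rewrite exprS -[ltRHS]mulrA ltr_pM2l// divr_gt0.
  apply: le_trans (gl _ _ (w _ _ A1) (w _ _ B1)) _.
  by rewrite exprS -[leRHS]mulrA ler_wpM2l// divr_ge0.
exists r => //; split => // x y k xr yr.
have [A1 A2 A3] := il k _ _ xr yr; have [B1 B2 _] := il k _ _ yr xr.
have e z : kseq g k.+1 z - kseq g k z = 2 ^+ k *: (2 *: g (iter k g z) - iter k g z).
  by rewrite /kseq /= scalerBr scalerA -exprSr.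
rewrite !e -scalerBr normrZ normrX ger0_norm//.
have q0 : (0 : R) <= 2 / 3 by rewrite divr_ge0.
have q1 : (2 / 3) ^+ k * r <= r.
  by rewrite ler_piMl ?(ltW r0)// exprn_ile1//; lra.
apply: le_trans (ler_wpM2l _ (hl _ _ _ q1 A1 B1)) _; first by rewrite exprn_ge0.
have h1 : K * ((2 / 3) ^+ k * r) * `|iter k g x - iter k g y| <=
    6^-1 * (2 / 3) ^+ k * ((2 / 3) ^+ k * `|x - y|).
  apply: ler_pM => //; first by rewrite !mulr_ge0 ?exprn_ge0// ltW.
  by rewrite mulrCA mulrC ler_wpM2r// exprn_ge0.
apply: le_trans (_ : 2 ^+ k * (2 * (6^-1 * (2 / 3) ^+ k * ((2 / 3) ^+ k * `|x - y|))) <= _).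
  by rewrite ler_wpM2l ?exprn_ge0// ler_wpM2l.
rewrite (_ : (8 / 9) ^+ k = 2 ^+ k * (2 / 3) ^+ k * (2 / 3) ^+ k); last first.
  by rewrite -!exprMn; congr (_ ^+ k); field.
have P0 : 0 <= 2 ^+ k * (2 / 3) ^+ k * (2 / 3) ^+ k * `|x - y|.
  by rewrite !mulr_ge0 ?exprn_ge0.
rewrite (_ : 2 ^+ k * _ = 3^-1 * (2 ^+ k * (2 / 3) ^+ k * (2 / 3) ^+ k * `|x - y|)).
  by rewrite [leRHS]mulrC; lra.
by field.
Qed.

Section local.
Variables (E : normedModType R) (U : set E) (g : E -> E).
Hypothesis hb : half_basin U g.

Let oU : open U. Proof. by have [[]] := hb. Qed.
Let sg : smooth_on U g. Proof. by have [[]] := hb. Qed.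
Let U0 : U 0. Proof. by have [[]] := hb. Qed.
Let g0 : g 0 = 0. Proof. by have [[]] := hb. Qed.
Let dg0 v : 'd g 0 v = 2^-1 *: v. Proof. by have [[]] := hb. Qed.
Let gU x : U x -> U (g x). Proof. by have [_ [H _]] := hb; exact: H. Qed.

Lemma iter_basin k x : U x -> U (iter k g x).
Proof. by move=> Ux; elim: k => //= k; exact: gU. Qed.

Lemma smooth_iter k : smooth_on U (iter k g).
Proof.
move=> n; elim: k => [|k IH]; first by apply: Cn_lin => // x; exact: cvg_id.
by apply: (@Cn_comp R n _ _ _ U U (iter k g) g) => //= x; exact: iter_basin.
Qed.

Lemma iter_tmap k x v : U x ->
  iter k (tmap g) (x, v) = (iter k g x, 'd (iter k g) x v).
Proof.
move=> Ux; elim: k => [|k IH]; first by rewrite /= diff_id.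
rewrite iterS IH /tmap; congr (_, _).
have dk := smooth_on_diff (smooth_iter k) Ux.
have dg := smooth_on_diff sg (iter_basin k Ux).
exact: (esym (congr1 (fun u => u v) (diff_comp dk dg))).
Qed.

Lemma kseq_diff k x v : U x ->
  differentiable (kseq g k) x /\ 'd (kseq g k) x v = 2 ^+ k *: 'd (iter k g) x v.
Proof.
move=> Ux; have dk := smooth_on_diff (smooth_iter k) Ux.
by split; [exact: differentiableZ|rewrite (diffZ _ dk)].
Qed.

Lemma kseqD k m x : kseq g (k + m) x = 2 ^+ m *: kseq g k (iter m g x).
Proof. by rewrite /kseq scalerA -exprD addnC -iterD addnC. Qed.

Lemma kseq0 k : kseq g k 0 = 0.
Proof. by rewrite /kseq (_ : iter k g 0 = 0) ?scaler0//; elim: k => //= k ->. Qed.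

(** At (0, 0) the second derivative term vanishes, so the differential is 1/2 in both components.
    The base component of an orbit enters the small ball; from then on the vector component shrinks
    by 2/3 at each step whatever its size, being transformed linearly. *)
Lemma half_basin_tmap : half_basin [set p : E * E | U p.1] (tmap g).
Proof.
have oU' := @open_fst E E _ oU.
have st := smooth_on_tmap oU sg.
split; last split.
- split => //; first by rewrite /tmap /= g0 linear0.
  move=> [h k]; rewrite (diff_tmapE sg)// (diff_tmap_horiz sg)// !dg0 add0r.
  by [].
- by move=> p; exact: gU.
move=> [x v] e /= Ux e0.
have [r r0 [rU dr gr _]] := half_germ_bound hb.1.
have [_ [_ att]] := hb; have [m xmr] := att x r Ux r0.
pose xm := iter m g x; pose vm := 'd (iter m g) x v.
have h k : `|(iter k (tmap g) (xm, vm)).1| <= (2 / 3) ^+ k * `|xm| /\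
    `|(iter k (tmap g) (xm, vm)).2| <= (2 / 3) ^+ k * `|vm|.
  elim: k => [|k [IH1 IH2]]; first by rewrite !expr0 !mul1r.
  rewrite iterS /tmap /=.
  move: (iter k _ _) IH1 IH2 => [a b] /= IH1 IH2.
  have ar : `|a| < r.
    apply: le_lt_trans IH1 _; apply: le_lt_trans xmr.
    by rewrite ler_piMl// exprn_ile1//; lra.
  rewrite !exprS; split.
    have := gr a 0 ar; rewrite normr0 g0 !subr0 => /(_ r0) /le_trans; apply.
    by rewrite -[leRHS]mulrA ler_wpM2l.
  by apply: le_trans (dr _ _ ar) _; rewrite -[leRHS]mulrA ler_wpM2l.
have S0 : 0 < `|xm| + `|vm| + 1 by rewrite ltr_wpDl// addr_ge0.
have q01 : 0 <= (2 / 3 : R) < 1 by lra.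
have [k kq] := expr_lt q01 (divr_gt0 e0 S0).
exists (k + m)%N; rewrite iterD iter_tmap// -/xm -/vm.
have [h1 h2] := h k.
have q0 : 0 <= (2 / 3 : R) ^+ k by rewrite exprn_ge0//; lra.
rewrite ltr_pdivlMr// in kq.
rewrite prod_normE /= gt_max; apply/andP; split.
  apply: le_lt_trans h1 _; apply: le_lt_trans kq; rewrite ler_wpM2l//.
  by rewrite -addrA lerDl addr_ge0.
apply: le_lt_trans h2 _; apply: le_lt_trans kq; rewrite ler_wpM2l//.
by rewrite -addrA addrCA lerDl addr_ge0.
Qed.

End local.
End HalfBasin.

(** * Differentiability of a limit of maps *)

Section LimitDiff.
Variable R : realType.

Lemma diff_bound (E F : normedModType R) (f : E -> F) (x : E) (L : R) :
  differentiable f x -> (\forall y \near x, `|f y - f x| <= L * `|y - x|) ->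
  forall v, `|'d f x v| <= L * `|v|.
Proof.
move=> df /near_norm[r r0 H] v; apply/ler_addgt0Pr => e e0.
pose m := `|v| + 1; have m0 : 0 < m by rewrite ltr_wpDl.
have /near_norm[s s0 Hs] := diff_cvg df (divr_gt0 e0 m0).
have rs0 : 0 < Num.min r s by rewrite lt_min r0.
have [t t0 tm] : exists2 t : R, 0 < t & t * m < Num.min r s.
  exists (Num.min r s / 2 / m); first by rewrite !divr_gt0.
  by rewrite mulfVK ?gt_eqF//; lra.
have tv : t * `|v| < Num.min r s.
  by apply: le_lt_trans tm; rewrite ler_wpM2l ?lerDl// ltW.
move: tv; rewrite lt_min => /andP[tr ts].
have := H (t *: v + x); rewrite addrK normrZ gtr0_norm// => /(_ tr) h1.
have := Hs (t *: v); rewrite subr0 linearZ_LR normrZ gtr0_norm// => /(_ ts) h2.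
rewrite -(ler_pM2l t0) -{1}(gtr0_norm t0) -normrZ.
have -> : t *: 'd f x v = (f (t *: v + x) - f x) -
    (f (t *: v + x) - f x - t *: 'd f x v) by rewrite subKr.
apply: le_trans (ler_normB _ _) _; rewrite mulrDr; apply: lerD.
  by apply: le_trans h1 _; rewrite mulrCA.
apply: le_trans h2 _; rewrite mulrCA ler_wpM2l ?(ltW t0)//.
by rewrite mulrAC ler_pdivrMr// ler_wpM2l ?(ltW e0)// lerDl.
Qed.

(** The neighbourhood in the last hypothesis may depend on k, yet the bound passes to differentials
    at x: those of f_k and f_l differ little in operator norm for large k and l. So psi is a uniform
    limit on bounded sets, hence continuous, and it is the differential of f. *)
Lemma limit_diff (E F : normedModType R) (f_ : nat -> E -> F) (f psi : E -> F) (x : E) :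
  (forall k, differentiable (f_ k) x) ->
  (forall v, 'd (f_ k) x v @[k --> \oo] --> psi v) ->
  (forall e, 0 < e -> exists N, forall k, (N <= k)%N ->
     \forall y \near x, `|(f y - f_ k y) - (f x - f_ k x)| <= e * `|y - x|) ->
  differentiable f x /\ 'd f x = psi :> (E -> F).
Proof.
move=> df dpsi H.
have psi_lin : linear psi.
  move=> a u v; apply: (cvg_unique (@norm_hausdorff _ _)) (dpsi _) _.
  rewrite (_ : (fun k => _) = (fun k => a *: 'd (f_ k) x u + 'd (f_ k) x v)).
    by apply: cvgD (dpsi v); exact: (cvgZl_tmp (dpsi u)).
  by apply/funext => k; rewrite linearP.
have unif e : 0 < e -> exists k, (forall v, `|psi v - 'd (f_ k) x v| <= e * `|v|) /\
    \forall y \near x, `|(f y - f_ k y) - (f x - f_ k x)| <= e * `|y - x|.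
  move=> e0; have e20 : 0 < e / 2 by rewrite divr_gt0.
  have [N HN] := H _ e20; exists N; split; last first.
    apply: filterS (HN _ (leqnn N)) => y /le_trans; apply.
    by rewrite ler_wpM2r//; lra.
  move=> v; apply/ler_addgt0Pr => d d0.
  have /cvgrPdist_lt/(_ d d0)[M _ HM] := dpsi v.
  have := HM (N + M)%N (leq_addl _ _); set l := (N + M)%N => /= h1.
  have h2 : `|'d (f_ l) x v - 'd (f_ N) x v| <= e * `|v|.
    have := @diff_bound _ _ (f_ l - f_ N) x e (differentiableB (df l) (df N)) _ v.
    rewrite (diffB (df l) (df N)); apply.
    apply: filterS2 (HN _ (leqnn N)) (HN l (leq_addr _ _)) => y a1 a2.
    have -> : (f_ l - f_ N) y - (f_ l - f_ N) x = (f y - f_ N y - (f x - f_ N x)) -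
        (f y - f_ l y - (f x - f_ l x)).
      rewrite -[LHS]/((f_ l y - f_ N y) - (f_ l x - f_ N x)) [RHS]subrACA.
      by congr (_ - _); rewrite [RHS]subrACA subrr sub0r opprB.
    apply: le_trans (ler_normB _ _) _; lra.
  apply: le_trans (ler_distD ('d (f_ l) x v) _ _) _.
  by rewrite addrC lerD// ltW.
pose P : {linear E -> F} := HB.pack psi (GRing.isLinear.Build R E F _ psi psi_lin).
have Pc : continuous P.
  have [k [kpsi _]] := unif 1 ltr01.
  have [K K0 HK] := linear_lipschitz (diff_continuous (df k)).
  apply: (bounded_linear_cont (K := 1 + K)) => v.
  rewrite mulrDl -[P v](subrK ('d (f_ k) x v)).
  by apply: le_trans (ler_normD _ _) _; rewrite lerD//; exact: kpsi.
apply: (@diff_cvgE R E F f P x Pc) => e e0.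
have e30 : 0 < e / 3 by rewrite divr_gt0.
have [k [k1 k2]] := unif _ e30.
have s0 : (h + x) @[h --> (0 : E)] --> x.
  rewrite -[X in _ --> X]add0r; apply: cvgD; [exact: cvg_id|exact: cvg_cst].
have k2' : \forall h \near (0 : E),
    `|(f (h + x) - f_ k (h + x)) - (f x - f_ k x)| <= e / 3 * `|h + x - x|.
  exact: (s0 _ k2).
apply: filterS2 k2' (diff_cvg (df k) e30) => h h1 h2.
rewrite addrK in h1; have h3 := k1 h.
have -> : f (h + x) - f x - P h = (f (h + x) - f_ k (h + x) - (f x - f_ k x)) +
    (f_ k (h + x) - f_ k x - 'd (f_ k) x h) - (psi h - 'd (f_ k) x h).
  by rewrite [in RHS]subrACA subrKA opprB subrKA.
apply: le_trans (ler_normB _ _) _.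
apply: le_trans (lerD (ler_normD _ _) (lexx _)) _; lra.
Qed.

End LimitDiff.

(** * Convergence and smoothness of the Koenigs limit *)

Section KoenigsLimit.
Variable R : realType.

Definition klim (E : normedModType R) (g : E -> E) (x : E) : E :=
  lim (kseq g k x @[k --> \oo]).

Lemma kseq_cvg_iter (E : normedModType R) (g : E -> E) m (x l : E) :
  kseq g k (iter m g x) @[k --> \oo] --> l ->
  kseq g k x @[k --> \oo] --> 2 ^+ m *: l.
Proof.
move=> hl.
rewrite -(cvg_shiftn m) (_ : (fun n => _) = fun k => 2 ^+ m *: kseq g k (iter m g x)).
  exact: (cvgZl_tmp hl).
by apply/funext => k; rewrite kseqD.
Qed.

(** Geometric convergence is available on the small ball only; the orbit of x gets there after m
    steps, which amount to a factor 2^m in the limit. *)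
Lemma kseq_cvg (E : completeNormedModType R) (U : set E) (g : E -> E) (x : E) :
  half_basin U g -> U x -> kseq g k x @[k --> \oo] --> klim g x.
Proof.
move=> hb Ux; apply/cvg_ex.
have [r r0 [rU _ _ H]] := half_germ_bound hb.1.
have [_ [_ att]] := hb; have [m xm] := att x r Ux r0.
have q01 : 0 <= (8 / 9 : R) < 1 by lra.
have /cvg_ex[l hl] : cvgn (kseq g ^~ (iter m g x)).
  apply: (@geometric_cvg R E _ `|iter m g x| (8 / 9)) => // k.
  by have := H _ 0 k xm; rewrite normr0 !(kseq0 hb) !subr0; exact.
by exists (2 ^+ m *: l); exact: kseq_cvg_iter.
Qed.

Section limit.
Variables (E : normedModType R) (U : set E) (g phi : E -> E).
Hypothesis hb : half_basin U g.
Hypothesis cvphi : forall x, U x -> kseq g k x @[k --> \oo] --> phi x.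

Lemma kseq_limit_iter m x : U x -> phi x = 2 ^+ m *: phi (iter m g x).
Proof.
move=> Ux; apply: (cvg_unique (@norm_hausdorff _ _)) (cvphi Ux) _.
exact/kseq_cvg_iter/cvphi/(iter_basin hb).
Qed.

(** On the small ball phi - [kseq g k] has Lipschitz constant 9 (8/9)^k; [iter m g] transports this
    to a neighbourhood of any point of the basin. *)
Lemma kseq_limit_lipschitz x0 e : U x0 -> 0 < e ->
  exists N, forall k, (N <= k)%N -> exists2 r : R, 0 < r &
    forall x y, `|x - x0| < r -> `|y - x0| < r ->
      `|(phi x - kseq g k x) - (phi y - kseq g k y)| <= e * `|x - y|.
Proof.
move=> Ux0 e0.
have [r r0 [rU _ _ H]] := half_germ_bound hb.1.
have [_ [_ att]] := hb; have [m xm] := att x0 r Ux0 r0.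
have [[oU sg _ _ _] _] := hb.
have [L L0 [s s0 gL]] := Cn1_lipschitz oU (smooth_iter hb m 1) Ux0.
have N1 : \forall x \near x0, U x by exact: open_nbhs_nbhs.
have N2 : \forall x \near x0, `|iter m g x| < r.
  have gc : {for x0, continuous (iter m g)} by exact: (smooth_iter hb m 0).
  have /cvgrPdist_lt/(_ (r - `|iter m g x0|)) := gc.
  rewrite subr_gt0 => /(_ xm); apply: filterS => x.
  rewrite distrC ltrBrDr => xr; apply: le_lt_trans xr.
  by have := ler_normD (iter m g x - iter m g x0) (iter m g x0); rewrite subrK.
have [t t0 [ts Ht]] := near_normI s0 N1 N2.
(* 2^m comes from undoing m steps, 9 is 1 / (1 - 8/9), and L is the Lipschitz constant of [iter m g]
   near x0. *)
have C0 : 0 < 2 ^+ m * 9 * L by rewrite !mulr_gt0// exprn_gt0.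
have q01 : 0 <= (8 / 9 : R) < 1 by lra.
have [N qN] := expr_lt q01 (divr_gt0 e0 C0).
exists (N + m)%N => k Nk; exists t => // x y xt yt.
have [Ux xr] := Ht _ xt; have [Uy yr] := Ht _ yt.
have mk : (m <= k)%N by rewrite (leq_trans _ Nk)// leq_addl.
rewrite (kseq_limit_iter m Ux) (kseq_limit_iter m Uy) -(subnK mk) !kseqD.
set j := (k - m)%N; set a := iter m g x; set b := iter m g y.
rewrite -!scalerBr normrZ ger0_norm ?exprn_ge0//.
have Nj : (N <= j)%N by rewrite /j leq_subRL// addnC.
have Ua := iter_basin hb m Ux; have Ub := iter_basin hb m Uy.
rewrite subrACA.
have h1 : `|phi a - phi b - (kseq g j a - kseq g j b)| <=
    `|a - b| / (1 - 8 / 9) * (8 / 9) ^+ j.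
  apply: (@geometric_limit_dist R E (fun j => kseq g j a - kseq g j b)) => //.
    by move=> i; rewrite subrACA; exact: H.
  by apply: cvgB; exact: cvphi.
have h2 : (8 / 9 : R) ^+ j <= (8 / 9) ^+ N by apply: ler_wiXn2l => //; lra.
have h3 : `|a - b| <= L * `|x - y|.
  by apply: gL; [exact: lt_le_trans xt ts|exact: lt_le_trans yt ts].
have h4 : `|a - b| / (1 - 8 / 9) * (8 / 9) ^+ j <=
    L * `|x - y| / (1 - 8 / 9) * (e / (2 ^+ m * 9 * L)).
  apply: ler_pM; [by rewrite divr_ge0//; lra|by rewrite exprn_ge0//; lra| |].
    by rewrite ler_wpM2r// invr_ge0; lra.
  exact: le_trans h2 (ltW qN).
apply: le_trans (ler_wpM2l _ (le_trans h1 h4)) _; first by rewrite exprn_ge0.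
rewrite le_eqVlt; apply/orP; left; apply/eqP; field.
by rewrite gt_eqF//= gt_eqF// exprn_gt0.
Qed.

Lemma kseq_limit_continuous x : U x -> {for x, continuous phi}.
Proof.
move=> Ux; have [N HN] := kseq_limit_lipschitz Ux ltr01.
have [r r0 H] := HN N (leqnn N).
have c1 : {for x, continuous (fun y => phi y - kseq g N y)}.
  by apply: locally_lipschitz_continuous; exists 1 => //; exists r.
have c2 : {for x, continuous (kseq g N)}.
  by have [d _] := kseq_diff hb N 0 Ux; exact: differentiable_continuous.
rewrite (_ : phi = fun y => phi y - kseq g N y + kseq g N y).
  exact: cvgD c1 c2.
by apply/funext => y; rewrite subrK.
Qed.

Lemma kseq_limit_diff (psi : E -> E) x : U x ->
  (forall v, 2 ^+ k *: 'd (iter k g) x v @[k --> \oo] --> psi v) ->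
  differentiable phi x /\ 'd phi x = psi :> (E -> E).
Proof.
move=> Ux psiE; apply: (limit_diff (f_ := kseq g)).
- by move=> k; have [] := kseq_diff hb k 0 Ux.
- move=> v; rewrite (_ : (fun k => _) = fun k => 2 ^+ k *: 'd (iter k g) x v)//.
  by apply/funext => k; have [_ ->] := kseq_diff hb k v Ux.
move=> e e0; have [N HN] := kseq_limit_lipschitz Ux e0; exists N => k /HN[r r0 H].
by apply/near_norm; exists r => // y yr; apply: H => //; rewrite subrr normr0.
Qed.

End limit.

Lemma kseq_tmap (E : normedModType R) (U : set E) (g : E -> E) k x v :
  half_basin U g -> U x ->
  kseq (tmap g) k (x, v) = (kseq g k x, 2 ^+ k *: 'd (iter k g) x v).
Proof. by move=> hb Ux; rewrite /kseq (iter_tmap hb)//. Qed.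

(* The tangent prolongation of [g] satisfies the same hypotheses as [g], and
   its Koenigs limit is the tangent prolongation of that of [g]: this gains
   one derivative at each step of the induction. *)
Lemma klim_smooth (E : completeNormedModType R) (U : set E) (g : E -> E) :
  half_basin U g -> smooth_on U (klim g).
Proof.
move=> + n; elim: n E U g => [|n IH] E U g hb.
  by move=> x; apply: (kseq_limit_continuous hb) => y; exact: kseq_cvg.
have hbt := half_basin_tmap hb.
have [[oU _ _ _ _] _] := hb.
have D x : U x -> differentiable (klim g) x /\
    'd (klim g) x = (fun v => (klim (tmap g) (x, v)).2) :> (E -> E).
  move=> Ux; apply: (kseq_limit_diff hb) => // [y|v]; first exact: kseq_cvg.
  have h := @kseq_cvg (E * E)%type _ _ (x, v) hbt Ux.
  have sc : {for klim (tmap g) (x, v), continuous (snd : E * E -> E)} by exact: cvg_snd.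
  have := cvg_comp _ _ h sc; rewrite (_ : snd \o _ = fun k => 2 ^+ k *: 'd (iter k g) x v).
    by [].
  by apply/funext => k; exact: (congr1 snd (kseq_tmap k v hb Ux)).
split; first by move=> x /D[].
apply: (@Cn_congr R n _ _ _ (snd \o klim (tmap g))).
- exact: open_fst.
- by move=> [x v] /= /D[_ ->].
apply: (@Cn_comp R n _ _ _ [set p : E * E | U p.1] setT) => //; first exact: open_fst.
  exact: (IH (E * E)%type _ _ hbt).
by apply: Cn_lin => // p; exact: cvg_snd.
Qed.

Lemma klim_step (E : completeNormedModType R) (U : set E) (g : E -> E) x :
  half_basin U g -> U x -> klim g x = 2 *: klim g (g x).
Proof.
move=> hb Ux.
by rewrite (kseq_limit_iter hb (fun y => @kseq_cvg E U g y hb) 1 Ux) expr1.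
Qed.

Lemma klim0 (E : completeNormedModType R) (U : set E) (g : E -> E) :
  half_basin U g -> klim g 0 = 0.
Proof.
move=> hb; apply: cvg_lim; first exact: norm_hausdorff.
by rewrite (_ : (fun k => _) = cst 0); [exact: cvg_cst|apply/funext => k; rewrite (kseq0 hb)].
Qed.

(** The tangent iterates at (0, w) are exactly (0, 2^-k w), so the rescaled differentials form a
    constant sequence. *)
Lemma klim_diff0 (E : completeNormedModType R) (U : set E) (g : E -> E) v :
  half_basin U g -> 'd (klim g) 0 v = v.
Proof.
move=> hb; have [[_ sg U0 g0 dg0] _] := hb.
have [||_ ->//] := @kseq_limit_diff E U g (klim g) hb _ id 0 U0.
  by move=> y; exact: kseq_cvg.
move=> w; rewrite (_ : (fun k => _) = cst w); first exact: cvg_cst.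
apply/funext => k.
suff : iter k (tmap g) (0, w) = (0, 2 ^- k *: w).
  by rewrite (iter_tmap hb)// => -[_ ->]; rewrite scalerA mulfV ?scale1r// expf_neq0.
elim: k => [|k IH]; first by rewrite /= expr0 invr1 scale1r.
by rewrite iterS IH /tmap /= g0 dg0 scalerA exprS invfM.
Qed.

End KoenigsLimit.

(** * Linearizing a map with derivative 2 *)

Section Linearization.
Variable R : realType.

Lemma half_germ_basin (E : normedModType R) (U : set E) (g : E -> E) :
  half_germ U g -> exists2 U', U' `<=` U & half_basin U' g.
Proof.
move=> hg; have [_ sg _ g0 dg0] := hg.
have [r r0 [rU _ gr _]] := half_germ_bound hg.
have z0 : `|0 : E| < r by rewrite normr0.
exists [set x | `|x| < r]; first by move=> x /rU.
have gx (x : E) : `|x| < r -> `|g x| <= 2 / 3 * `|x|.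
  by move=> xr; have := gr _ _ xr z0; rewrite g0 !subr0.
have gxr (x : E) : `|x| < r -> `|g x| < r.
  by move=> xr; have := gx _ xr; have := normr_ge0 x; lra.
split; last split => //.
- split => //; last by move=> n; apply: Cn_sub (sg n) => x /rU.
  rewrite openE => x xr; apply/near_norm; exists (r - `|x|); first by rewrite subr_gt0.
  move=> y; rewrite ltrBrDr; apply: le_lt_trans.
  by have := ler_normD (y - x) x; rewrite subrK.
move=> x e xr e0.
have q01 : 0 <= (2 / 3 : R) < 1 by lra.
have [n qn] := expr_lt q01 (divr_gt0 e0 r0).
exists n; rewrite ltr_pdivlMr// in qn; apply: le_lt_trans qn.
suff [] : `|iter n g x| <= (2 / 3) ^+ n * r /\ `|iter n g x| < r by [].
elim: n => [|n [IH1 IH2]]; first by rewrite expr0 mul1r ltW.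
split; last exact: gxr.
apply: le_trans (gx _ IH2) _.
by rewrite exprS -[leRHS]mulrA ler_wpM2l//; lra.
Qed.

Theorem doubling_linearization (E : completeNormedModType R) (U : set E) (d : E -> E) :
  open U -> smooth_on U d -> U 0 -> d 0 = 0 -> (forall v, 'd d 0 v = 2 *: v) ->
  exists (W V : set E) (phi psi : E -> E),
    [/\ diffeo W V phi psi, W 0 & W `<=` U] /\
    [/\ phi 0 = 0, forall v, 'd phi 0 v = v &
        \forall x \near 0, phi (d x) = 2 *: phi x].
Proof.
move=> oU sd U0 d0 dd0.
have n2 : (2 : R) != 0 by [].
have [W1 [V1 [g [W10 W1U dfg]]]] := inverse_function_scale n2 oU sd U0 dd0.
have [[oW1 oV1 sd1 sg] [WV VW gK dK]] := dfg.
have g0 : g 0 = 0 by rewrite -{1}d0 gK.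
have V10 : V1 0 by rewrite -d0; exact: WV.
have dg0 v : 'd g 0 v = 2^-1 *: v.
  rewrite -[X in 'd g X]d0; apply: (diffeo_diffK dfg W10).
  by rewrite dd0 scalerA mulfV// scale1r.
have hg : half_germ (V1 `&` U) g.
  by split => //; [exact: openI|move=> n; apply: Cn_sub (sg n) => x []].
have [U' U'V hb] := half_germ_basin hg.
have [[oU' _ U'0 _ _] _] := hb.
have [W [V [psi [W0 WU' dfpsi]]]] :=
  inverse_function_id oU' (klim_smooth hb) U'0 (fun v => klim_diff0 v hb).
exists W, V, (klim g), psi; split; first by split => // x /WU' /U'V[].
split; [exact: klim0 hb|by move=> v; exact: klim_diff0 hb|].
have dc : {for 0, continuous d}.
  exact/differentiable_continuous/(smooth_on_diff sd).
have N1 : \forall x \near 0, W1 x by exact: open_nbhs_nbhs.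
have N2 : \forall x \near 0, U' (d x).
  by apply: dc; apply: open_nbhs_nbhs; rewrite d0.
apply: filterS2 N1 N2 => x W1x U'dx.
(* The functional equation of [klim g] is used at d x, where g (d x) = x. *)
by rewrite (klim_step hb U'dx) gK.
Qed.

End Linearization.

(** * Linearization of the doubling map of a symmetric space *)

Section Multiplication.
Variable R : realType.

Lemma diff_inl (E F : normedModType R) (a : F) (x v : E) :
  differentiable (fun z : E => (z, a)) x /\ 'd (fun z : E => (z, a)) x v = (v, 0).
Proof.
split; first exact: (differentiable_pair (differentiable_id x) (differentiable_cst a x)).
rewrite (diff_pair (differentiable_id x) (differentiable_cst a x)) /=.
by rewrite (@diff_cst R E F a x) diff_id.
Qed.

Lemma diff_inr (E F : normedModType R) (a : E) (y w : F) :
  differentiable (fun z : F => (a, z)) y /\ 'd (fun z : F => (a, z)) y w = (0, w).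
Proof.
split; first exact: (differentiable_pair (differentiable_cst a y) (differentiable_id y)).
rewrite (diff_pair (differentiable_cst a y) (differentiable_id y)) /=.
by rewrite (@diff_cst R F E a y) diff_id.
Qed.

Lemma diff_diag (E : normedModType R) (x v : E) :
  differentiable (fun z : E => (z, z)) x /\ 'd (fun z : E => (z, z)) x v = (v, v).
Proof.
split; first exact: (differentiable_pair (differentiable_id x) (differentiable_id x)).
by rewrite (diff_pair (differentiable_id x) (differentiable_id x)) /= !diff_id.
Qed.

Lemma Cn_cst n (E F : normedModType R) (U : set E) (a : F) : Cn n U (fun=> a).
Proof.
case: n => [|n]; first by move=> x _; exact: cvg_cst.
split; first by move=> x _; exact: differentiable_cst.
rewrite (_ : (fun p => _) = cst 0); last by apply/funext => p; rewrite diff_cst.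
by apply: Cn_lin; [move=> c u v; rewrite scaler0 addr0|move=> x; exact: cvg_cst].
Qed.

Lemma Cn_inl n (E F : normedModType R) (U : set E) (a : F) :
  open U -> Cn n U (fun z : E => (z, a)).
Proof.
move=> oU; apply: Cn_pair => //; last exact: Cn_cst.
by apply: Cn_lin => // x; exact: cvg_id.
Qed.

Lemma Cn_inr n (E F : normedModType R) (U : set F) (a : E) :
  open U -> Cn n U (fun z : F => (a, z)).
Proof.
move=> oU; apply: (@Cn_comp R n _ _ _ U setT (fun z => (z, a)) (fun p => (p.2, p.1))) => //.
  exact: Cn_inl.
apply: Cn_lin => // p; apply: cvg_pair; [exact: cvg_snd|exact: cvg_fst].
Qed.

Lemma Cn_add n (E F : normedModType R) (U : set E) (f g : E -> F) :
  open U -> Cn n U f -> Cn n U g -> Cn n U (fun x => f x + g x).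
Proof.
move=> oU Cf Cg.
apply: (@Cn_comp R n _ _ _ U setT (fun x => (f x, g x)) (fun p : F * F => p.1 + p.2)) => //.
  exact: Cn_pair.
apply: Cn_lin; first by move=> c u v; rewrite scalerDr addrACA.
by move=> p; apply: cvgD; [exact: cvg_fst|exact: cvg_snd].
Qed.

Section involution.
Variables (E : normedModType R) (U : set E) (s : E -> E).
Hypotheses (oU : open U) (U0 : U 0) (ss : smooth_on U s) (s0 : s 0 = 0).
Hypothesis sK : \forall x \near 0, s (s x) = x.

Let A : {linear E -> E} := 'd s 0.

Let ds : differentiable s 0. Proof. exact: smooth_on_diff ss U0. Qed.

Let Ac : continuous A. Proof. exact: diff_continuous. Qed.

Let AA w : A (A w) = w.
Proof.
have ds' : differentiable s (s 0) by rewrite s0.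
have e1 := congr1 (fun u => u w) (diff_comp ds ds').
have [_ e2] := @diff_congr R E E id (s \o s) 0 (filterS (fun x => esym) sK)
  (differentiable_id 0).
have e3 y : y = 0 -> 'd s y (A w) = A (A w) by move=> ->.
rewrite -(e3 _ s0) -[LHS]e1; exact: etrans (congr1 (fun u => u w) e2) (diff_id 0 w).
Qed.

(* Intertwines [s] with its differential: chi (s x) = A (chi x). *)
Definition involution_chart (x : E) : E := 2^-1 *: (x + A (s x)).

Let chi := involution_chart.

Lemma smooth_involution_chart : smooth_on U chi.
Proof.
move=> n; apply: Cn_scale => //; apply: Cn_add => //.
  by apply: Cn_lin => // x; exact: cvg_id.
apply: (@Cn_comp R n _ _ _ U setT s A) => //.
by apply: Cn_lin => // c x y; rewrite linearP.
Qed.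

Lemma diff_involution_chart w : 'd chi 0 w = w.
Proof.
have dA := linear_differentiable (s 0) Ac.
have dAs : differentiable (A \o s) 0 by exact: differentiable_comp.
have did := differentiable_id (0 : E).
have d1 := differentiableD did dAs.
have -> : 'd chi 0 w = 2^-1 *: ('d id 0 w + 'd (A \o s) 0 w).
  have e1 := congr1 (fun u => u w) (diffZ 2^-1 d1).
  exact: etrans e1 (congr1 (fun u => 2^-1 *: u w) (diffD did dAs)).
rewrite diff_id (congr1 (fun u => u w) (diff_comp ds dA)) /= (@diff_lin R E E A)//.
by rewrite -/A AA -mulr2n -[w *+ 2]scaler_nat scalerA mulVf// scale1r.
Qed.

(** Since chi conjugates s to A, a vector u fixed by A yields fixed points of s arbitrarily close to
    0, so u = 0 by isolatedness. This applies to u = v + A v, which is fixed because A is an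
    involution. *)
Lemma involution_diff_opp W V rho : diffeo W V chi rho -> W 0 ->
  (\forall x \near 0, s x = x -> x = 0) -> forall v, A v = - v.
Proof.
move=> [[oW oV _ srho] [WV VW rhoK chiK]] W0 sfix v.
have sc : {for 0, continuous s} by exact: differentiable_continuous.
have chi0 : chi 0 = 0 by rewrite /chi /involution_chart s0 add0r linear0 scaler0.
have V0 : V 0 by rewrite -chi0; exact: WV.
have rho0 : rho 0 = 0 by rewrite -{1}chi0 rhoK.
have N1 : \forall x \near 0, W (s x).
  by apply: sc; apply: open_nbhs_nbhs; rewrite s0.
have rc : {for 0, continuous rho}.
  exact/differentiable_continuous/(smooth_on_diff srho).
have N2 : \forall z \near 0, [/\ W (s (rho z)), s (s (rho z)) = rho z &
    s (rho z) = rho z -> rho z = 0].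
  have : \forall x \near rho 0, [/\ W (s x), s (s x) = x & s x = x -> x = 0].
    by rewrite rho0; apply: filterS3 N1 sK sfix.
  exact: rc.
have N3 : \forall z \near 0, V z by exact: open_nbhs_nbhs.
have [r r0 [_ H]] := near_normI ltr01 N2 N3.
pose u := v + A v.
have Au : A u = u by rewrite /u linearD AA addrC.
suff u0 : u = 0 by apply/eqP; rewrite -addr_eq0 addrC -/u u0.
have [t t0 tr] : exists2 t : R, 0 < t & t * `|u| < r.
  have m0 : 0 < `|u| + 1 by rewrite ltr_wpDl.
  exists (r / (`|u| + 1)); first by rewrite divr_gt0.
  by rewrite mulrAC ltr_pdivrMr// ltr_pM2l// ltrDl.
have [|[Wsx ssx fx] Vtu] := H (t *: u).
  by rewrite subr0 normrZ gtr0_norm.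
set x := rho (t *: u) in Wsx ssx fx.
have chix : chi x = t *: u by exact: chiK.
have Wx : W x by exact: VW.
have : s x = x.
  rewrite -(rhoK _ Wsx) -[RHS](rhoK _ Wx); congr rho.
  have -> : chi (s x) = A (chi x).
    by rewrite /chi /involution_chart ssx linearZ_LR [A (_ + _)]linearD [A (A _)]AA addrC.
  by rewrite chix linearZ_LR Au.
move=> /fx x0; move: chix; rewrite x0 chi0 => /esym/eqP.
by rewrite scaler_eq0 gt_eqF//= => /eqP.
Qed.

End involution.

Lemma diff_involution (E : completeNormedModType R) (U : set E) (s : E -> E) v :
  open U -> U 0 -> smooth_on U s -> s 0 = 0 ->
  (\forall x \near 0, s (s x) = x) -> (\forall x \near 0, s x = x -> x = 0) ->
  'd s 0 v = - v.
Proof.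
move=> oU U0 ss s0 sK sfix.
have schi : smooth_on U (involution_chart s) by exact: smooth_involution_chart.
have dchi w : 'd (involution_chart s) 0 w = w.
  by apply: (diff_involution_chart (U := U)).
have [W [V [rho [W0 _ dW]]]] := inverse_function_id oU schi U0 dchi.
exact: (involution_diff_opp (U := U)) dW W0 sfix v.
Qed.

Lemma diff_doubling (E : completeNormedModType R) (U : set (E * E)) (m : E * E -> E) :
  open U -> U (0, 0) -> smooth_on U m -> (\forall x \near 0, m (x, x) = x) ->
  (\forall x \near 0, m (0, m (0, x)) = x) ->
  (\forall x \near 0, m (0, x) = x -> x = 0) ->
  forall v, 'd (fun x => m (x, 0)) 0 v = 2 *: v.
Proof.
move=> oU U0 sm mid minv mfix v.
have m0 : m (0, 0) = 0 by exact: nbhs_singleton mid.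
have dm := smooth_on_diff sm U0.
have [dr drE] := diff_inr (0 : E) (0 : E) v.
have [dl dlE] := diff_inl (0 : E) (0 : E) v.
have [dd ddE] := diff_diag (0 : E) v.
have e1 : 'd (fun x => m (0, x)) 0 v = - v.
  have oU' : open [set x | U (0, x)].
    by apply: open_comp => // x _; apply: cvg_pair; [exact: cvg_cst|exact: cvg_id].
  apply: (@diff_involution E [set x | U (0, x)]) => // n.
  by apply: (@Cn_comp R n _ _ _ [set x | U (0, x)] U) => //; exact: Cn_inr.
have e2 : 'd (fun x => m (0, x)) 0 v = 'd m (0, 0) (0, v).
  by rewrite -drE; exact: (congr1 (fun u => u v) (diff_comp dr dm)).
have e3 : 'd (fun x => m (x, 0)) 0 v = 'd m (0, 0) (v, 0).
  by rewrite -dlE; exact: (congr1 (fun u => u v) (diff_comp dl dm)).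
have e4 : v = 'd m (0, 0) (v, v).
  have [_ e] := @diff_congr R E E id (fun x => m (x, x)) 0
    (filterS (fun x => esym) mid) (differentiable_id 0).
  have e' := congr1 (fun u => u v) (diff_comp dd dm).
  rewrite -ddE -[LHS](diff_id (0 : E) v).
  exact: etrans (esym (congr1 (fun u => u v) e)) e'.
have -> : 'd (fun x => m (x, 0)) 0 v = 'd m (0, 0) (v, v) - 'd m (0, 0) (0, v).
  rewrite e3 -linearB; congr ('d m _ _).
  by rewrite -[RHS]/(v - 0, v - v) subr0 subrr.
by rewrite -e4 -e2 e1 opprK scaler_nat mulr2n.
Qed.

End Multiplication.

(** * Logarithms: charts in which doubling is linear *)

Section Shift.
Variable R : realType.

Lemma Cn_shift n (E F : normedModType R) (U : set E) (f : E -> F) (p : E) :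
  open U -> Cn n U f -> Cn n [set x | U (x + p)] (fun x => f (x + p)).
Proof.
move=> oU Cf.
have sc : continuous (fun x : E => x + p).
  by move=> x; apply: cvgD; [exact: cvg_id|exact: cvg_cst].
have oV : open [set x | U (x + p)] by apply: open_comp => // x _; exact: sc.
apply: (@Cn_comp R n _ _ _ [set x | U (x + p)] U (fun x => x + p) f) => //.
apply: Cn_add; [by []|by apply: Cn_lin => // x; exact: cvg_id|exact: Cn_cst].
Qed.

Lemma diff_shift (E F : normedModType R) (f : E -> F) (x p : E) v :
  differentiable f (x + p) ->
  differentiable (fun z => f (z + p)) x /\ 'd (fun z => f (z + p)) x v = 'd f (x + p) v.
Proof.
move=> df.
have did := differentiable_id x.
have dc := differentiable_cst p x.
have ds : differentiable (fun z : E => z + p) x by exact: (differentiableD did dc).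
split; first exact: (differentiable_comp ds df).
rewrite [LHS](congr1 (fun u => u v) (diff_comp ds df)) /=.
congr ('d f _ _).
rewrite [LHS](congr1 (fun u => u v) (diffD did dc)) /=.
by rewrite -[LHS]/('d id x v + 'd (cst p) x v) diff_id diff_cst addr0.
Qed.

End Shift.

Section Logarithm.
Variable R : realType.

(* [lg] is a chart at [b] in which the doubling map x |-> x . b is multiplication
   by 2; smoothness is only recorded with respect to the chart that defines the
   tangent space at [b]. *)
Record is_log (M : symmetric_space R) (b : M) (W : set M) (V : set (tangent b))
    (lg : M -> tangent b) (ex : tangent b -> M) : Prop := IsLog {
  log_dom_open : open W;
  log_cod_open : open V;
  log_dom_base : W b;
  log_dom_chart : W `<=` chart_dom (chart_at M b);
  log_cod : forall x, W x -> V (lg x);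
  exp_dom : forall y, V y -> W (ex y);
  logK : forall x, W x -> ex (lg x) = x;
  expK : forall y, V y -> lg (ex y) = y;
  log_continuous : forall x, W x -> {for x, continuous lg};
  exp_continuous : forall y, V y -> {for y, continuous ex};
  log_smooth : smooth_on
    [set y | chart_cod (chart_at M b) y /\ W (of_model (chart_at M b) y)]
    (lg \o of_model (chart_at M b));
  exp_smooth : smooth_on V (to_model (chart_at M b) \o ex);
  log_base : lg b = 0;
  log_diff : forall v,
    'd (lg \o of_model (chart_at M b)) (to_model (chart_at M b) b) v = v;
  log_doubling : \forall x \near b, lg (sym_mul x b) = 2 *: lg x
}.

Section log_exists.
Variables (M : symmetric_space R) (b : M).
Let c := chart_at M b.
Let p := to_model c b.
Let mu := rep (fun q : prod_manifold M M => sym_mul q.1 q.2) (prod_chart c c) c.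
Let D := rep_dom (fun q : prod_manifold M M => sym_mul q.1 q.2) (prod_chart c c) c.

Let db : chart_dom c b. Proof. exact: chart_at_dom. Qed.
Let cp : chart_cod c p. Proof. exact: to_model_cod. Qed.
Let mulc : continuous (fun q : M * M => sym_mul q.1 q.2).
Proof. exact: (sym_mul_smooth M).1. Qed.

Let oD : open D. Proof. exact: rep_dom_open. Qed.

(** U and m are the domain and the expression of the multiplication in the chart at b, translated so
    that b becomes 0, the fixed point that [doubling_linearization] expects. *)
Let U : set (model c * model c) := [set q | D (q + (p, p))].
Let m (q : model c * model c) : model c := mu (q + (p, p)) - p.

Let oU : open U.
Proof.
apply: open_comp => // q _; apply: cvgD; [exact: cvg_id|exact: cvg_cst].
Qed.

Let sm : smooth_on U m.
Proof.
move=> n; apply: Cn_add; [exact: oU| |exact: Cn_cst].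
by apply: Cn_shift; [exact: oD|exact: ((sym_mul_smooth M).2 (b, b) b n)].
Qed.

Let U0 : U (0, 0).
Proof.
rewrite /U /= -[X in D X]/(0 + p, 0 + p) add0r; split; first by split.
by rewrite /= to_modelK// sym_mul_id.
Qed.

Let near_model (P : M -> Prop) :
  (\forall x \near b, P x) -> \forall y \near 0, chart_cod c (y + p) /\ P (of_model c (y + p)).
Proof.
move=> HP.
have sc : (y + p) @[y --> (0 : model c)] --> p.
  rewrite -[X in _ --> X]add0r; apply: cvgD; [exact: cvg_id|exact: cvg_cst].
have N1 : \forall y \near p, chart_cod c y.
  by apply: open_nbhs_nbhs; split => //; exact: chart_cod_open.
have N2 : \forall y \near p, P (of_model c y).
  by apply: (@of_model_continuous _ _ c p cp); rewrite to_modelK.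
exact: (sc _ (filterI N1 N2)).
Qed.

Lemma log_exists : exists W V lg ex, @is_log M b W V lg ex.
Proof.
have mb y : m (0, y) = to_model c (sym_mul b (of_model c (y + p))) - p.
  rewrite /m -[(0, y) + (p, p)]/(0 + p, y + p) add0r /mu /rep /=.
  by rewrite to_modelK.
have mbd y : m (y, 0) = to_model c (sym_mul (of_model c (y + p)) b) - p.
  rewrite /m -[(y, 0) + (p, p)]/(y + p, 0 + p) add0r /mu /rep /=.
  by rewrite to_modelK.
have dom_near : \forall x \near b, chart_dom c x.
  by apply: open_nbhs_nbhs; split => //; exact: chart_dom_open.
have bc : {for b, continuous (sym_mul b)}.
  apply: (@continuous_comp _ (M * M)%type _ (fun x => (b, x)) (fun q => sym_mul q.1 q.2)).
    by apply: cvg_pair; [exact: cvg_cst|exact: cvg_id].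
  exact: mulc.
have dom_near' : \forall x \near b, chart_dom c (sym_mul b x).
  by apply: bc; rewrite sym_mul_id.
have m_id : \forall x \near 0, m (x, x) = x.
  apply: filterS (near_model dom_near) => x [cx _].
  rewrite /m -[(x, x) + (p, p)]/(x + p, x + p) /mu /rep /= sym_mul_id of_modelK//.
  by rewrite addrK.
have m_inv : \forall x \near 0, m (0, m (0, x)) = x.
  apply: filterS (near_model dom_near') => x [cx dx].
  rewrite !mb subrK to_modelK//.
  by rewrite sym_mul_invol of_modelK// addrK.
have m_fix : \forall x \near 0, m (0, x) = x -> x = 0.
  apply: filterS (near_model (filterI dom_near' (sym_mul_isolated b))) => x [cx [dx fx]].
  rewrite mb => /(congr1 (fun z => z + p)); rewrite subrK => e.
  have /fx /(congr1 (to_model c)) : sym_mul b (of_model c (x + p)) = of_model c (x + p).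
    by rewrite -[LHS](to_modelK dx) e.
  by rewrite of_modelK// => /(congr1 (fun z => z - p)); rewrite addrK subrr.
have dm v := diff_doubling oU U0 sm m_id m_inv m_fix v.
have oU1 : open [set x | U (x, 0)].
  by apply: open_comp => // x _; apply: cvg_pair; [exact: cvg_id|exact: cvg_cst].
have sd : smooth_on [set x | U (x, 0)] (fun x => m (x, 0)).
  move=> n; apply: (@Cn_comp R n _ _ _ [set x | U (x, 0)] U (fun x => (x, 0)) m) => //.
  exact: Cn_inl.
have m0 : m (0, 0) = 0 by exact: nbhs_singleton m_id.
have [W [V [phi [psi [[dW W0 WU] [phi0 dphi dbl]]]]]] :=
  doubling_linearization oU1 sd U0 m0 dm.
have [[oW oV sphi spsi] [WV VW phiK psiK]] := dW.
have Wcod x : W x -> chart_cod c (x + p).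
  by move=> /WU; rewrite /U /= -[_ + (p, p)]/(x + p, 0 + p) => -[[]].
have subc : continuous (fun x : model c => x - p).
  by move=> x; apply: cvgD; [exact: cvg_id|exact: cvg_cst].
pose WM := [set x | chart_dom c x /\ W (to_model c x - p)].
have tc x : chart_dom c x -> {for x, continuous (fun x => to_model c x - p)}.
  move=> dx; apply: (@continuous_comp _ _ _ (to_model c) (fun z => z - p)).
    exact: to_model_continuous.
  exact: subc.
have oWM : open WM.
  rewrite openE => x [dx Wx].
  have N1 : \forall z \near x, chart_dom c z.
    by apply: open_nbhs_nbhs; split => //; exact: chart_dom_open.
  have N2 : \forall z \near x, W (to_model c z - p).
    by apply: (tc _ dx); exact: open_nbhs_nbhs.
  by apply: filterS2 N1 N2 => z.
have dS : [set y | chart_cod c y /\ WM (of_model c y)] =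
    chart_cod c `&` [set y | W (y - p)].
  apply/seteqP; split => y [cy] /=.
    by move=> [_]; rewrite of_modelK.
  by move=> Wy; split => //; split; [exact: of_model_dom|rewrite of_modelK].
have oS : open (chart_cod c `&` [set y | W (y - p)]).
  apply: openI; first exact: chart_cod_open.
  by apply: open_comp => // x _; exact: subc.
have lgE : forall y, (chart_cod c `&` [set y | W (y - p)]) y ->
    phi (y - p) = ((fun x => phi (to_model c x - p)) \o of_model c) y.
  by move=> y [cy _]; rewrite /= of_modelK.
exists WM, V, (fun x => phi (to_model c x - p)), (fun y => of_model c (psi y + p)).
split.
- exact: oWM.
- exact: oV.
- by split => //; rewrite /= subrr.
- by move=> x [].
- by move=> x [_ /WV].
- move=> y /VW Wy; split; first exact/of_model_dom/Wcod.
  by rewrite of_modelK ?addrK//; exact: Wcod.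
- by move=> x [dx Wx]; rewrite phiK// subrK to_modelK.
- by move=> y Vy; rewrite of_modelK ?addrK ?psiK//; exact/Wcod/VW.
- move=> x [dx Wx]; apply: (@continuous_comp _ _ _ (fun x => to_model c x - p) phi).
    exact: tc.
  exact: (sphi 0).
- move=> y Vy; apply: (@continuous_comp _ _ _ (fun y => psi y + p) (of_model c)).
    by apply: cvgD; [exact: (spsi 0)|exact: cvg_cst].
  exact/of_model_continuous/Wcod/VW.
- rewrite -/c dS => n; apply: (Cn_congr oS lgE).
  by apply: Cn_sub (Cn_shift (- p) oW (sphi n)) => y [].
- move=> n; apply: (@Cn_congr R n _ _ V (fun y => psi y + p)) => //.
    by move=> y /VW /Wcod Wy; rewrite /= of_modelK.
  by apply: Cn_add => //; exact: Cn_cst.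
- by rewrite -/c -/p subrr.
- move=> v; have dphi' z : z = 0 -> differentiable phi z /\ 'd phi z v = v.
    by move=> ->; split; [exact: smooth_on_diff sphi W0|exact: dphi].
  have [d1 d2] := dphi' _ (subrr p).
  have [d3 d4] := diff_shift v d1.
  have N : \forall y \near p, phi (y - p) =
      ((fun x => phi (to_model c x - p)) \o of_model c) y.
    have : \forall y \near p, (chart_cod c `&` [set y | W (y - p)]) y.
      by apply: open_nbhs_nbhs; split => //; split => //=; rewrite subrr.
    by apply: filterS => y; exact: lgE.
  have [_ e] := diff_congr N d3.
  by rewrite -[RHS]d2 -d4; exact: (congr1 (fun u => u v) e).
have tb : (to_model c x - p) @[x --> b] --> (0 : model c).
  by rewrite -(subrr p); exact: tc.
have N : \forall x \near b, phi (m (to_model c x - p, 0)) = 2 *: phi (to_model c x - p).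
  exact: (tb _ dbl).
apply: filterS2 N dom_near => x /= + dx.
by rewrite mbd subrK to_modelK.
Qed.

End log_exists.
End Logarithm.

(** * Morphisms in logarithmic charts *)

Section LogMorphism.
Variable R : realType.

(** One has h v = 2^k h (2^-k v) for every k, and by differentiability at 0 the right-hand side
    tends to Dh(0) v. Only halvings of v occur, so the points stay in the ball where the doubling
    relation holds. *)
Lemma homogeneous_diff (E F : normedModType R) (h : E -> F) :
  differentiable h 0 -> (\forall v \near 0, h (2 *: v) = 2 *: h v) ->
  \forall v \near 0, h v = 'd h 0 v.
Proof.
move=> dh /near_norm[r r0 H].
have h0 : h 0 = 0.
  have := H 0; rewrite subr0 normr0 scaler0 => /(_ r0) /eqP.
  by rewrite scaler_nat mulr2n -subr_eq0 opprD addrA subrr sub0r oppr_eq0 => /eqP.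
apply/near_norm; exists r => // v; rewrite subr0 => vr.
have q01 : 0 <= (2^-1 : R) < 1 by lra.
have k0 k : 0 <= (2^-1 : R) ^+ k by rewrite exprn_ge0//; lra.
have hk k : h v = 2 ^+ k *: h (2^-1 ^+ k *: v).
  elim: k => [|k IH]; first by rewrite !expr0 !scale1r.
  rewrite IH exprSr -scalerA -H; first by rewrite scalerA exprS mulrA mulfV// mul1r.
  rewrite subr0 normrZ (ger0_norm (k0 _)).
  apply: le_lt_trans vr; rewrite ler_piMl// exprn_ile1//; lra.
apply/eqP; rewrite -subr_eq0 -normr_le0; apply/ler_addgt0Pr => e e0; rewrite add0r.
have m0 : 0 < `|v| + 1 by rewrite ltr_wpDl.
have /near_norm[s s0 Hs] := diff_cvg dh (divr_gt0 e0 m0).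
have [k kq] := expr_lt q01 (divr_gt0 s0 m0).
have := Hs (2^-1 ^+ k *: v).
rewrite subr0 addr0 h0 subr0 linearZ_LR normrZ (ger0_norm (k0 _)) => /(_ _) h1.
have {}h1 := h1 ltac:(by rewrite ltr_pdivlMr// in kq; apply: le_lt_trans kq;
  rewrite ler_wpM2l// lerDl).
rewrite (hk k).
have -> : 'd h 0 v = 2 ^+ k *: (2^-1 ^+ k *: 'd h 0 v).
  by rewrite scalerA -exprMn mulfV// expr1n scale1r.
rewrite -scalerBr normrZ ger0_norm ?exprn_ge0//.
apply: le_trans (ler_wpM2l _ h1) _; first by rewrite exprn_ge0.
rewrite mulrCA [X in _ * X]mulrA -exprMn mulfV// expr1n mul1r mulrAC ler_pdivrMr//.
by rewrite ler_wpM2l ?lerDl// ltW.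
Qed.

Section log_facts.
Variables (M : symmetric_space R) (b : M) (W : set M) (V : set (tangent b)).
Variables (lg : M -> tangent b) (ex : tangent b -> M).
Hypothesis L : is_log W V lg ex.
Let c := chart_at M b.

Lemma log_cod0 : V 0.
Proof. by rewrite -(log_base L); exact/(log_cod L)/(log_dom_base L). Qed.

Lemma exp0 : ex 0 = b.
Proof. by rewrite -(log_base L) (logK L)//; exact: log_dom_base L. Qed.

Lemma log_near : \forall x \near b, W x.
Proof.
by apply: open_nbhs_nbhs; split; [exact: log_dom_open L|exact: log_dom_base L].
Qed.

Lemma exp_near : \forall v \near 0, V v.
Proof. by apply: open_nbhs_nbhs; split; [exact: log_cod_open L|exact: log_cod0]. Qed.

Lemma exp_cvg : ex v @[v --> (0 : tangent b)] --> b.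
Proof. by rewrite -[X in _ --> X]exp0; exact/(exp_continuous L)/log_cod0. Qed.

Lemma log_cvg : lg x @[x --> b] --> (0 : tangent b).
Proof. by rewrite -(log_base L); exact/(log_continuous L)/(log_dom_base L). Qed.

Lemma log_model_differentiable : differentiable (lg \o of_model c) (to_model c b).
Proof.
apply: (smooth_on_diff (log_smooth L)); split => /=.
  exact/to_model_cod/chart_at_dom.
by rewrite to_modelK; [exact: log_dom_base L|exact: chart_at_dom].
Qed.

Lemma exp_model_diff v : differentiable (to_model c \o ex) 0 /\ 'd (to_model c \o ex) 0 v = v.
Proof.
have d1 : differentiable (to_model c \o ex) 0.
  exact: smooth_on_diff (exp_smooth L) log_cod0.
split => //.
have p0 : to_model c (ex 0) = to_model c b by rewrite exp0.
have d2 : differentiable (lg \o of_model c) ((to_model c \o ex) 0).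
  by rewrite /= p0; exact: log_model_differentiable.
have N : \forall z \near 0, id z = ((lg \o of_model c) \o (to_model c \o ex)) z.
  apply: filterS exp_near => z Vz /=.
  rewrite to_modelK ?(expK L)//; exact/(log_dom_chart L)/(exp_dom L).
have [_ e1] := diff_congr N (differentiable_id 0).
have e2 := congr1 (fun u => u v) (diff_comp d1 d2).
have e3 z w : z = to_model c b -> 'd (lg \o of_model c) z w = w.
  by move=> ->; exact: log_diff L w.
rewrite -[LHS](e3 _ _ p0); apply: etrans (esym e2) _.
exact: etrans (congr1 (fun u => u v) e1) (diff_id 0 v).
Qed.

End log_facts.

Lemma smooth_rep_differentiable (A B : topologicalType) (f : A -> B)
    (c : chart R A) (d : chart R B) x :
  smooth_rep f c d -> chart_dom c x -> chart_dom d (f x) ->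
  differentiable (rep f c d) (to_model c x).
Proof.
move=> sf cx dx; apply: (smooth_on_diff sf); split; first exact: to_model_cod.
by rewrite to_modelK.
Qed.

Lemma log_morphism (M N : symmetric_space R) (f : M -> N) (b : M) W V lg ex W' V' lg' ex' :
  morphism f -> @is_log R M b W V lg ex -> @is_log R N (f b) W' V' lg' ex' ->
  \forall x \near b, lg' (f x) = tangent_map f b (lg x).
Proof.
move=> [[fc fs] fmul] L L'.
pose c := chart_at M b; pose c' := chart_at N (f b).
have fcb : {for b, continuous f} by exact: fc.
pose h := lg' \o f \o ex.
have N1 := log_near L; have N2 := exp_near L; have N3 := log_near L'.
have N4 : \forall x \near b, W' (f x) by exact: fcb.
have N5 : \forall v \near (0 : tangent b), W' (f (ex v)) by exact: (exp_cvg L N4).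
have [dex _] := exp_model_diff L 0.
have p0 : to_model c (ex 0) = to_model c b by rewrite (exp0 L).
have drep : differentiable (rep f c c') (to_model c b).
  by apply: smooth_rep_differentiable; [exact: fs|exact: chart_at_dom|exact: chart_at_dom].
have rep0 : rep f c c' (to_model c b) = to_model c' (f b).
  by rewrite /rep /= to_modelK//; exact: chart_at_dom.
have dlg' := log_model_differentiable L'.
have [dh dhE] : differentiable h 0 /\ forall v, 'd h 0 v = tangent_map f b v.
  (* Smoothness of lg' and ex is recorded in the charts defining the tangent spaces, so h is
     differentiated through this factorization, with which it agrees near 0. *)
  pose h' := (lg' \o of_model c') \o (rep f c c' \o (to_model c \o ex)).
  have d1 : differentiable (rep f c c') ((to_model c \o ex) 0) by rewrite /= p0.
  have d2 := differentiable_comp dex d1.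
  have d3 : differentiable (lg' \o of_model c') ((rep f c c' \o (to_model c \o ex)) 0).
    by rewrite /= p0 rep0.
  have d4 := differentiable_comp d2 d3.
  have N6 : \forall v \near (0 : tangent b), h' v = h v.
    apply: filterS2 N2 N5 => v Vv W'v.
    rewrite /h' /h /rep /=.
    rewrite [of_model c (to_model c _)]to_modelK; last first.
      exact/(log_dom_chart L)/(exp_dom L).
    by rewrite to_modelK//; exact: (log_dom_chart L').
  have [dh e] := @diff_congr R (tangent b) (tangent (f b)) h' h 0 N6 d4; split => // v.
  rewrite [LHS](congr1 (fun u => u v) e).
  rewrite [LHS](congr1 (fun u => u v) (diff_comp d2 d3)) /=.
  have e3 z w : z = to_model c' (f b) -> 'd (lg' \o of_model c') z w = w.
    by move=> ->; exact: log_diff L' w.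
  rewrite [LHS]e3; last by rewrite p0 rep0.
  rewrite [LHS](congr1 (fun u => u v) (diff_comp dex d1)) /=.
  have [_ ->] := exp_model_diff L v.
  by rewrite /tangent_map -/c -/c' p0.
have hdbl : \forall v \near (0 : tangent b), h (2 *: v) = 2 *: h v.
  have mb : {for b, continuous (fun x => sym_mul x b)}.
    apply: (@continuous_comp _ (M * M)%type _ (fun x => (x, b)) (fun q => sym_mul q.1 q.2)).
      by apply: cvg_pair; [exact: cvg_id|exact: cvg_cst].
    exact: (sym_mul_smooth M).1.
  have A1 : \forall x \near b, W (sym_mul x b) by apply: mb; rewrite sym_mul_id.
  have A2 : \forall x \near b, lg' (sym_mul (f x) (f b)) = 2 *: lg' (f x).
    exact: (fcb _ (log_doubling L')).
  have A : \forall x \near b, lg (sym_mul x b) = 2 *: lg x /\ W (sym_mul x b) /\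
      lg' (sym_mul (f x) (f b)) = 2 *: lg' (f x).
    by apply: filterS3 (log_doubling L) A1 A2 => x.
  have A' : \forall v \near (0 : tangent b), lg (sym_mul (ex v) b) = 2 *: lg (ex v) /\
      W (sym_mul (ex v) b) /\ lg' (sym_mul (f (ex v)) (f b)) = 2 *: lg' (f (ex v)).
    exact: (exp_cvg L A).
  apply: filterS2 A' N2 => v [a1 [a2 a3]] Vv.
  by rewrite /h /= -a3 -fmul -(logK L a2) a1 (expK L).
have H := homogeneous_diff dh hdbl.
have H' : \forall x \near b, h (lg x) = 'd h 0 (lg x) by exact: (log_cvg L H).
apply: filterS2 H' N1 => x + Wx.
by rewrite /h /= (logK L Wx) => ->; exact: dhE.
Qed.

End LogMorphism.

(** * Tangent spaces of submanifolds *)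

Section SubTangent.
Variable R : realType.

Lemma diff_rep_comp (A B C : topologicalType) (f : A -> B) (g : B -> C)
    (c : chart R A) (d : chart R B) (e : chart R C) x v :
  continuous f -> smooth_rep f c d -> smooth_rep g d e ->
  chart_dom c x -> chart_dom d (f x) -> chart_dom e (g (f x)) ->
  'd (rep (g \o f) c e) (to_model c x) v =
  'd (rep g d e) (to_model d (f x)) ('d (rep f c d) (to_model c x) v).
Proof.
move=> fc sf sg cx dx ex.
have df := smooth_rep_differentiable sf cx dx.
have dg := smooth_rep_differentiable sg dx ex.
have p0 : rep f c d (to_model c x) = to_model d (f x) by rewrite /rep /= to_modelK.
have dg' : differentiable (rep g d e) (rep f c d (to_model c x)) by rewrite p0.
have N : \forall y \near to_model c x,
    (rep g d e \o rep f c d) y = rep (g \o f) c e y.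
  have : \forall y \near to_model c x, rep_dom f c d y.
    apply: open_nbhs_nbhs; split; first exact: rep_dom_open.
    by split; [exact: to_model_cod|rewrite to_modelK].
  by apply: filterS => y [_ dy]; rewrite /rep /= to_modelK.
have [_ E] := @diff_congr R _ _ _ _ _ N (differentiable_comp df dg').
rewrite [LHS](congr1 (fun u => u v) E).
rewrite [LHS](congr1 (fun u => u v) (diff_comp df dg')).
by rewrite /= p0.
Qed.

Lemma diff_rep_id (A : topologicalType) (c : chart R A) x v :
  chart_dom c x -> 'd (rep id c c) (to_model c x) v = v.
Proof.
move=> cx.
have N : \forall y \near to_model c x, id y = rep id c c y.
  have : \forall y \near to_model c x, chart_cod c y.
    by apply: open_nbhs_nbhs; split; [exact: chart_cod_open|exact: to_model_cod].
  by apply: filterS => y cy; rewrite /rep /= of_modelK.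
have [_ E] := @diff_congr R _ _ _ _ _ N (differentiable_id _).
by rewrite [LHS](congr1 (fun u => u v) E) diff_id.
Qed.

Section submanifold.
Variables (M : manifold R) (N : set M) (hN : submanifold N) (b : sub_manifold hN).
Let c := chart_at M (val b).
Let a := ambient_chart hN b.
Let F := ambient_subspace hN b.
Let s := sub_chart_at hN b.
Let i : set_type N -> M := val.

Let ab : chart_dom a (i b). Proof. by have [] := ambientP hN b. Qed.
Let cb : chart_dom c (i b). Proof. exact: chart_at_dom. Qed.
Let sb : chart_dom s b. Proof. exact: sub_chart_at_dom. Qed.
Let ac : smooth_rep id a c. Proof. by have [+ _] := ambient_smooth hN b (val b); exact. Qed.
Let ca : smooth_rep id c a. Proof. by have [_ +] := ambient_smooth hN b (val b); exact. Qed.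
Let isa : smooth_rep i s a. Proof. exact: smooth_rep_val. Qed.
Let ic : continuous i. Proof. exact: set_val_continuous. Qed.
Let idc : continuous (id : M -> M). Proof. exact: continuous_id. Qed.
Let isc : smooth_rep i s c.
Proof.
apply: (@smooth_rep_comp R _ M M i id) => // y [sy _]; exists a; split => //.
exact: (@of_model_dom _ _ s).
Qed.

(** The ambient tangent space is read in the chart c, whereas N is straight in the chart a; the
    differentials of the two transition maps translate between them. *)
Let toa : {linear tangent (i b) -> model a} := 'd (rep id c a) (to_model c (i b)).
Let ofa : {linear model a -> tangent (i b)} := 'd (rep id a c) (to_model a (i b)).
Let Ti : {linear tangent b -> tangent (i b)} := tangent_map (i : sub_manifold hN -> M) b.

Let diff_val w : 'd (rep i s a) (to_model s b) w = csval w.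
Proof.
have cvl : linear (@csval R (model a) F) by exact: csval_linear.
pose J : {linear csub F -> model a} :=
  HB.pack (@csval R (model a) F) (GRing.isLinear.Build R _ _ _ _ cvl).
have Jc : continuous J by exact: csval_continuous.
have dJ : differentiable J (to_model s b) by exact: linear_differentiable.
have Nn : \forall y \near to_model s b, J y = rep i s a y.
  have : \forall y \near to_model s b, chart_cod s y.
    by apply: open_nbhs_nbhs; split; [exact: chart_cod_open|exact: to_model_cod].
  apply: filterS => y /= sy; rewrite /rep /i /=.
  rewrite sub_of_modelE//; last exact: ambientE.
  exact: (esym (of_modelK (c := a) sy)).
have [_ E] := @diff_congr R _ _ _ _ _ Nn dJ.
by rewrite [LHS](congr1 (fun u => u w) E) (@diff_lin R _ _ J).
Qed.

Let toa_Ti w : toa (Ti w) = csval w.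
Proof. by rewrite -diff_val; exact: (esym (diff_rep_comp w ic isc ca sb cb ab)). Qed.

Let ofa_csval (w : tangent b) : ofa (csval w) = Ti w.
Proof. by rewrite -diff_val; exact: (esym (diff_rep_comp w ic isa ac sb ab cb)). Qed.

Let toaK v : ofa (toa v) = v.
Proof.
rewrite -[RHS](diff_rep_id v cb).
exact: (esym (diff_rep_comp v idc ca ac cb ab cb)).
Qed.

Let toac : continuous toa.
Proof.
apply: diff_continuous.
exact: smooth_rep_differentiable ca cb ab.
Qed.

(** Read in the straightening chart, the tangent map of the inclusion is the embedding of F. *)
Lemma range_tangent_val : range Ti = toa @^-1` F.
Proof.
apply/seteqP; split => v.
  by move=> [w _ <-]; rewrite /= toa_Ti; case: w => w wF; exact: set_mem.
move=> Fv; exists (CSub (mem_set Fv)) => //.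
by rewrite -ofa_csval /= toaK.
Qed.

Lemma range_tangent_val_closed : closed (range Ti).
Proof.
rewrite range_tangent_val; apply: preimage_closed; last exact: cs_closed.
by move=> v _; exact: toac.
Qed.

(** The embedding of F is isometric and [toa] is bounded. Thus a small ambient vector tangent to N
    comes from a small vector, as [log_subspace] needs. *)
Lemma tangent_val_bound : exists2 K : R, 0 < K & forall w, `|w| <= K * `|Ti w|.
Proof.
have [K K0 HK] := linear_lipschitz toac.
by exists K => // w; rewrite -csval_norm -toa_Ti.
Qed.

End submanifold.
End SubTangent.

(** * Symmetric subspaces in logarithmic charts *)

Section LogSubspace.
Variable R : realType.

(** N carries the induced topology, so its neighbourhoods are traces of neighbourhoods in the
    ambient space. Quantifying over y takes care of the points x outside N. *)
Lemma near_set_type (T : topologicalType) (N : set T) (b : set_type N)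
    (P : set_type N -> Prop) :
  (\forall y \near b, P y) ->
  \forall x \near (val b : T), forall y : set_type N, val y = x -> P y.
Proof.
move=> [_ [[W oW <-] /= Wb WP]].
have : \forall x \near (val b : T), W x by exact: open_nbhs_nbhs.
by apply: filterS => x Wx y yx; apply: WP; rewrite /= -yx in Wx.
Qed.

Lemma val_morphism (M : symmetric_space R) (N : set M) (hN : symmetric_subspace N) :
  @morphism R (sub_symmetric_space hN) M val.
Proof.
split; last by [].
have vc : continuous (val : set_type N -> M) by exact: set_val_continuous.
split => // x y.
apply: (@smooth_rep_comp R _ M M (val : set_type N -> M) id) => //.
  exact: continuous_id.
move=> q [xq _]; exists (ambient_chart hN.2 x); split.
- exact: (@of_model_dom _ _ (sub_chart_at hN.2 x)).
- exact: smooth_rep_val.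
- by have [] := ambient_smooth hN.2 x y.
Qed.

(** Serves to extend a comparison of such subspaces from a neighbourhood of 0 to all vectors. *)
Lemma Lts_sub_scale (M : symmetric_space R) (N : set M) (hN : symmetric_subspace N)
    b (hb : N b) (t : R) v :
  t != 0 -> Lts_sub hN b hb (t *: v) <-> Lts_sub hN b hb v.
Proof.
move=> t0; pose Ti := tangent_map (val : sub_manifold hN.2 -> M) (exist _ b (mem_set hb)).
split.
  move=> [w _ wv]; exists (t^-1 *: w) => //.
  rewrite -[RHS](scalerK t0) -wv; exact: (linearZ_LR Ti).
move=> [w _ <-]; exists (t *: w) => //; exact: (linearZ_LR Ti).
Qed.

(** From left to right, [log_morphism] is applied to the inclusion. Conversely, if lg x is small and
    the image of w, then w is small, and its exponential in N is a point with the same logarithm as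
    x, hence x itself. *)
Lemma log_subspace (M : symmetric_space R) (N : set M) (hN : symmetric_subspace N)
    b (hb : N b) W V lg ex :
  @is_log R M b W V lg ex -> \forall x \near b, N x <-> Lts_sub hN b hb (lg x).
Proof.
move=> L; pose bN : sub_symmetric_space hN := exist _ b (mem_set hb).
have [WN [VN [lgN [exN LN]]]] := log_exists bN.
have H := log_morphism (val_morphism hN) LN (L : @is_log R M (val bN) W V lg ex).
have H1 : \forall x \near b, forall y : set_type N, val y = x ->
    lg (val y) = tangent_map (val : sub_manifold hN.2 -> M) bN (lgN y).
  exact: (near_set_type H).
have [K K0 HK] := tangent_val_bound (bN : sub_manifold hN.2).
have N2 : \forall w \near (0 : tangent bN), VN w /\ W (val (exN w)) /\
    lg (val (exN w)) = tangent_map (val : sub_manifold hN.2 -> M) bN (lgN (exN w)).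
  have H2 : \forall y \near bN, W (val y) /\
      lg (val y) = tangent_map (val : sub_manifold hN.2 -> M) bN (lgN y).
    apply: filterI H.
    exact: (@set_val_continuous _ N bN _ (log_near L)).
  exact: (filterI (exp_near LN) (exp_cvg LN H2)).
have /near_norm[r r0 Hr] := N2.
have N3 : \forall x \near b, `|lg x| < r / K.
  have /cvgrPdist_lt/(_ (r / K) (divr_gt0 r0 K0)) := log_cvg L.
  by apply: filterS => x; rewrite sub0r normrN.
apply: filterS3 (log_near L) N3 H1 => x Wx xr H1x; split.
  move=> Nx; have := H1x (exist _ x (mem_set Nx)) erefl => /= ->.
  by exists (lgN (exist _ x (mem_set Nx))).
move=> [w _ wx].
have wr : `|w - 0| < r.
  rewrite subr0; apply: le_lt_trans (HK w) _; rewrite mulrC -ltr_pdivlMr//.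
  by rewrite -[X in `|X|]/(Lts_map (val : sub_symmetric_space hN -> M) bN w) wx.
have [Vw [Wy ly]] := Hr w wr.
have : lg (val (exN w)) = lg x by rewrite ly (expK LN).
move=> /(congr1 ex); rewrite !(logK L)// => <-.
exact: set_valP.
Qed.

End LogSubspace.

Section LogChart.
Variables (R : realType) (M : symmetric_space R) (b : M) (W : set M).
Variables (V : set (tangent b)) (lg : M -> tangent b) (ex : tangent b -> M).
Hypothesis L : is_log W V lg ex.

Definition log_chart : chart R M :=
  @Chart R M (tangent b) W V lg ex (log_dom_open L) (log_cod_open L) (log_cod L)
    (exp_dom L) (logK L) (expK L) (log_continuous L) (exp_continuous L).

Lemma log_chart_smooth : smooth_chart log_chart.
Proof.
move=> x; have idc := @continuous_id M.
have [cx xc] := chart_at_compatible b x.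
split; apply: (@smooth_rep_comp R M M M id id) => // y [y1 y2];
    exists (chart_at M b); split => //.
- exact/(log_dom_chart L)/(exp_dom L).
- by move=> n; apply: Cn_sub (exp_smooth L n) => z [].
- exact: (log_dom_chart L).
- exact: log_smooth L.
Qed.

(** A submanifold chart must straighten the subset on its whole domain, whereas [near_preimage]
    describes it only near b; hence the shrinking. *)
Lemma log_restrict (W' : set M) : open W' -> W' `<=` W -> W' b ->
  is_log W' (V `&` ex @^-1` W') lg ex.
Proof.
move=> oW' W'W W'b; split => //.
- rewrite openE => v [Vv W'v].
  have N1 : \forall z \near v, V z.
    by apply: open_nbhs_nbhs; split => //; exact: log_cod_open L.
  have N2 : \forall z \near v, W' (ex z).
    by apply: (exp_continuous L Vv); exact: open_nbhs_nbhs.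
  exact: filterI N1 N2.
- by move=> x /W'W /(log_dom_chart L).
- move=> x W'x; have Wx := W'W _ W'x; split; first exact: log_cod L _ Wx.
  by rewrite /= (logK L).
- by move=> y [].
- by move=> x /W'W /(logK L).
- by move=> y [/(expK L)].
- by move=> x /W'W /(log_continuous L).
- by move=> y [/(exp_continuous L)].
- by move=> n; apply: Cn_sub (log_smooth L n) => y [cy /W'W].
- by move=> n; apply: Cn_sub (exp_smooth L n) => y [].
- exact: log_base L.
- exact: log_diff L.
- exact: log_doubling L.
Qed.

End LogChart.

(** * The preimage of a symmetric subspace under a morphism *)

Section Preimage.
Variables (R : realType) (M1 M2 : symmetric_space R) (f : M1 -> M2).
Hypothesis hf : morphism f.
Variables (N2 : set M2) (hN2 : symmetric_subspace N2).

Let fc : continuous f. Proof. by have [[]] := hf. Qed.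

Lemma Lts_map_continuous b : continuous (Lts_map f b).
Proof.
apply: diff_continuous; apply: smooth_rep_differentiable; try exact: chart_at_dom.
by have [[_ fs] _] := hf; exact: fs.
Qed.

(** The logarithmic description of N2 at f b is pulled back along f, and [log_morphism] replaces lg2
    (f x) by the image of lg x under the tangent map. *)
Lemma near_preimage b (hb : N2 (f b)) W V lg ex : @is_log R M1 b W V lg ex ->
  \forall x \near b, N2 (f x) <-> Lts_sub hN2 (f b) hb (Lts_map f b (lg x)).
Proof.
move=> L; have [W2 [V2 [lg2 [ex2 L2]]]] := log_exists (f b).
have H : \forall x \near b, N2 (f x) <-> Lts_sub hN2 (f b) hb (lg2 (f x)).
  exact: (fc (log_subspace hN2 hb L2)).
apply: filterS2 H (log_morphism hf L L2) => x [h1 h2] e.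
by rewrite -[Lts_map f b (lg x)]e.
Qed.

Lemma Lts_sub_closed b (hb : N2 b) : closed (Lts_sub hN2 b hb).
Proof. exact: (@range_tangent_val_closed R M2 N2 hN2.2 (exist _ b (mem_set hb))). Qed.

Lemma Lts_sub_linear b (hb : N2 b) (t : R) u v :
  Lts_sub hN2 b hb u -> Lts_sub hN2 b hb v -> Lts_sub hN2 b hb (t *: u + v).
Proof.
pose Ti := tangent_map (val : sub_manifold hN2.2 -> M2) (exist _ b (mem_set hb)).
move=> [u' _ <-] [v' _ <-]; exists (t *: u' + v') => //; exact: (linearP Ti).
Qed.

Lemma Lts_sub0 b (hb : N2 b) : Lts_sub hN2 b hb 0.
Proof.
pose Ti := tangent_map (val : sub_manifold hN2.2 -> M2) (exist _ b (mem_set hb)).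
exists 0 => //; exact: (linear0 Ti).
Qed.

Let pre_set b (hb : N2 (f b)) : set (tangent b) :=
  Lts_map f b @^-1` Lts_sub hN2 (f b) hb.

Lemma preimage_zero b (hb : N2 (f b)) : pre_set hb 0.
Proof.
have e := linear0 (tangent_map f b).
(* [Lts_map f b] is a bare function; linearity is borrowed from [tangent_map f b], to which it is
   convertible. *)
exact: (eq_ind _ (Lts_sub hN2 (f b) hb) (Lts_sub0 hb) _ (esym e)).
Qed.

Lemma preimage_linear b (hb : N2 (f b)) (t : R) u v :
  pre_set hb u -> pre_set hb v -> pre_set hb (t *: u + v).
Proof.
move=> hu hv; have e := linearP (tangent_map f b) t u v.
exact: (eq_ind _ (Lts_sub hN2 (f b) hb) (Lts_sub_linear t hu hv) _ (esym e)).
Qed.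

Lemma preimage_Lts_closed b (hb : N2 (f b)) : closed (pre_set hb).
Proof.
apply: preimage_closed; last exact: Lts_sub_closed.
by move=> v _; exact: Lts_map_continuous.
Qed.

Lemma preimage_symmetric_subspace : symmetric_subspace (f @^-1` N2).
Proof.
split.
  by move=> x y /= Nx Ny; have [_ ->] := hf; exact: hN2.1.
move=> b hb; have [W [V [lg [ex L]]]] := log_exists b.
(* W' is open and the equivalence holds at each of its points, so it can serve as a chart domain. *)
have [W' [oW' W'b] W'P] : exists2 W', open_nbhs b W' & W' `<=` [set x |
    (N2 (f x) <-> Lts_sub hN2 (f b) hb (Lts_map f b (lg x))) /\ W x].
  have : nbhs b [set x | (N2 (f x) <-> Lts_sub hN2 (f b) hb (Lts_map f b (lg x))) /\ W x].
    by apply: filterI; [exact: near_preimage L|exact: log_near L].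
  by rewrite nbhsE.
have L' : is_log W' (V `&` ex @^-1` W') lg ex.
  by apply: (log_restrict L) => // x /W'P[].
exists (log_chart L').
exists (@ClosedSubspace R (tangent b) _ (preimage_zero hb) (@preimage_linear b hb)
  (@preimage_Lts_closed b hb)).
split; [exact: log_chart_smooth|exact: W'b|].
apply/seteqP; split => v /=.
  move=> [x [W'x Nx] <-]; split; first exact: log_cod L' _ W'x.
  by apply/(W'P _ W'x).1.
move=> [[Vv W'v] Fv]; exists (ex v); last exact: (expK L Vv).
split; first exact: W'v.
apply/(W'P _ W'v).1; rewrite (expK L)//.
Qed.

End Preimage.

Theorem proposition3p25 (R : realType) (M1 M2 : symmetric_space R)
    (f : M1 -> M2) (hf : morphism f)
    (N2 : set M2) (hN2 : symmetric_subspace N2) :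
  exists hN1 : symmetric_subspace (f @^-1` N2),
    forall (b1 : M1) (hb1 : N2 (f b1)),
      Lts_sub hN1 b1 hb1 = Lts_map f b1 @^-1` Lts_sub hN2 (f b1) hb1.
Proof.
exists (preimage_symmetric_subspace hf hN2) => b1 hb1.
set hN1 := preimage_symmetric_subspace hf hN2.
have [W [V [lg [ex L]]]] := log_exists b1.
(* Near b1 the same set has two logarithmic descriptions, as a symmetric subspace of M1 and as the
   preimage of N2. *)
have A : \forall x \near b1, Lts_sub hN1 b1 hb1 (lg x) <->
    Lts_sub hN2 (f b1) hb1 (Lts_map f b1 (lg x)).
  apply: filterS2 (near_preimage hf hN2 hb1 L) (log_subspace hN1 hb1 L) => x h1 h2.
  by rewrite -h1 -h2.
have B : \forall v \near (0 : tangent b1), Lts_sub hN1 b1 hb1 v <->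
    Lts_sub hN2 (f b1) hb1 (Lts_map f b1 v).
  have A' : \forall v \near (0 : tangent b1), Lts_sub hN1 b1 hb1 (lg (ex v)) <->
      Lts_sub hN2 (f b1) hb1 (Lts_map f b1 (lg (ex v))) by exact: (exp_cvg L A).
  by apply: filterS2 A' (exp_near L) => v + Vv; rewrite (expK L).
have /near_norm[r r0 Hr] := B.
suff C v : Lts_sub hN1 b1 hb1 v <-> Lts_sub hN2 (f b1) hb1 (Lts_map f b1 v).
  by apply/seteqP; split => v /C.
(* Both sides are invariant under nonzero scalars, and the factor r / (|v| + 1) brings v into the
   ball of radius r. *)
have m0 : 0 < `|v| + 1 by rewrite ltr_wpDl.
have t0 : 0 < r / (`|v| + 1) by rewrite divr_gt0.
rewrite -(Lts_sub_scale hN1 hb1 v (lt0r_neq0 t0)).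
rewrite -(Lts_sub_scale hN2 hb1 (Lts_map f b1 v) (lt0r_neq0 t0)).
rewrite -[X in _ <-> Lts_sub _ _ _ X](linearZ_LR (tangent_map f b1)).
apply: Hr; rewrite subr0 normrZ gtr0_norm//.
by rewrite mulrAC ltr_pdivrMr// ltr_pM2l// ltrDl.
Qed.
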